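(* For the Jacobi $\beta$-ensemble with weight $x^{\beta a/2}(1-x)^{\beta b/2}\chi_{0<x<1}$, $\kappa=\beta/2$, let $\overline W_n^{\rm J}(x_1,\dots,x_n;N,\kappa,a,b)$ be the $n$-point cumulant generating function (a formal series in $1/x_1,\dots,1/x_n$) with coefficients $\mu^{\rm J}_{p_1,\dots,p_n}(N,\kappa,a,b)$, extended to general parameter values through these coefficients. Then for every $n\ge1$ $$\overline W_n^{\rm J}(x_1,\dots,x_n;N,\kappa,a,b)=(-\kappa)^{-n}\,\overline W_n^{\rm J}(x_1,\dots,x_n;-\kappa N,\kappa^{-1},-\kappa a,-\kappa b).$$ Equivalently, for all nonnegative integers $p_1,\dots,p_n$, $$\mu^{\rm J}_{p_1,\dots,p_n}(N,\kappa,a,b)=(-\kappa)^{-n}\,\mu^{\rm J}_{p_1,\dots,p_n}(-\kappa N,\kappa^{-1},-\kappa a,-\kappa b).$$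
   Context: For a positive integer $N$, $\kappa=\beta/2>0$, the Jacobi $\beta$-ensemble here is the probability density on $(0,1)^N$ proportional to $$\prod_{l=1}^N\lambda_l^{\kappa a}(1-\lambda_l)^{\kappa b}\prod_{1\le j<k\le N}|\lambda_k-\lambda_j|^{2\kappa}.$$ $\mu^{\rm J}_{p_1,\dots,p_n}(N,\kappa,a,b)$ is the mixed (joint) cumulant of $\sum_j\lambda_j^{p_1},\dots,\sum_j\lambda_j^{p_n}$ (for $n=1$, the moment $\langle\sum_j\lambda_j^{p_1}\rangle$), and $$\overline W_n^{\rm J}(x_1,\dots,x_n;N,\kappa,a,b)=\frac1{x_1\cdots x_n}\sum_{p_1,\dots,p_n=0}^\infty\frac{\mu^{\rm J}_{p_1,\dots,p_n}(N,\kappa,a,b)}{x_1^{p_1}\cdots x_n^{p_n}}.$$ (Equivalently, with $A_i=\sum_j1/(x_i-\lambda_j)$, it is the large-$x$ expansion of $\langle A_1\rangle$ for $n=1$ and of the joint cumulant of $A_1,\dots,A_n$ for $n\ge2$.) The coefficients $\mu^{\rm J}_{p_1,\dots,p_n}$ are rational functions of $N,\kappa,a,b$, and these rational functions define $\mu^{\rm J}$ and $\overline W_n^{\rm J}$ for general parameters. The identities are between rational functions, respectively formal series with such coefficients. *)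

(* Defs.v *)
From HB Require Import structures.
From mathcomp Require Import all_boot all_order all_algebra fraction.
(* The notations of mpoly clash with those of the analysis library. *)
From mathcomp Require mpoly.
Import (canonicals) mpoly.

Set Implicit Arguments.
Unset Strict Implicit.
Unset Printing Implicit Defensive.

Import Order.TTheory GRing.Theory Num.Theory.

Local Open Scope ring_scope.

(* The joint cumulant of X_0, ..., X_(n-1) with respect to the expectation E,
   as a sum over the set partitions P of the index set. *)
Definition joint_cumulant (R : comNzRingType) (T : Type) (E : (T -> R) -> R)
    (n : nat) (X : 'I_n -> T -> R) : R :=
  \sum_(P : {set {set 'I_n}} | partition P [set: 'I_n])
    (-1) ^+ (#|P|.-1) * ((#|P|.-1)`!)%:R *
    \prod_(B in P) E (fun t => \prod_(i in B) X i t).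

(* Polynomials and rational functions in N, kappa, a, b, which are the
   variables of index 0, 1, 2, 3 in this order. *)
Definition param_poly (F : fieldType) := mpoly.mpoly 4 F.
Definition param_ratfun (F : fieldType) := {fraction mpoly.mpoly 4 F}.

Definition param_point (T : Type) (N kappa a b : T) : 'I_4 -> T :=
  tnth [tuple N; kappa; a; b].

Definition param_var (F : fieldType) (i : 'I_4) : param_ratfun F :=
  FracField.tofrac (mpoly.mpolyX F (mpoly.mnm1 i)).

Definition varN (F : fieldType) : param_ratfun F := param_var F (inord 0).
Definition varK (F : fieldType) : param_ratfun F := param_var F (inord 1).
Definition varA (F : fieldType) : param_ratfun F := param_var F (inord 2).
Definition varB (F : fieldType) : param_ratfun F := param_var F (inord 3).

(* f is defined at the point v, with value r. *)
Definition ratfun_value (F : fieldType) (f : param_ratfun F) (v : 'I_4 -> F)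
    (r : F) : Prop :=
  exists P Q : param_poly F,
    [/\ f = FracField.tofrac P / FracField.tofrac Q, mpoly.meval v Q != 0
      & r = mpoly.meval v P / mpoly.meval v Q].

(* f(N', kappa', a', b') for rational functions N', kappa', a', b'; the
   denominator of f does not vanish there as soon as these four are
   algebraically independent. *)
Definition ratfun_subst (F : fieldType) (f N' kappa' a' b' : param_ratfun F) :
    param_ratfun F :=
  let ev (P : param_poly F) : param_ratfun F :=
    mpoly.mmap (fun c : F => FracField.tofrac (mpoly.mpolyC 4 c))
      (param_point N' kappa' a' b') P in
  ev (\n_(repr f)) / ev (\d_(repr f)).

(* Formal series in 1/x_0, ..., 1/x_(n-1): s m is the coefficient of
   \prod_i x_i ^- (m i). *)
Definition inv_series (F : fieldType) (n : nat) :=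
  ('I_n -> nat) -> param_ratfun F.

(* (x_0 ... x_(n-1))^-1 \sum_p mu p / \prod_i x_i ^+ (p i) *)
Definition Wbar (F : fieldType) (n : nat)
    (mu : ('I_n -> nat) -> param_ratfun F) : inv_series F n :=
  fun m => if [forall i, (0 < m i)%N] then mu (fun i => (m i).-1) else 0.

Definition scale_series (F : fieldType) (n : nat) (c : param_ratfun F)
    (s : inv_series F n) : inv_series F n := fun m => c * s m.

From mathcomp Require Import all_classical all_reals all_analysis.

Import numFieldNormedType.Exports.

Local Open Scope ring_scope.

(* The integral over the open unit cube ]0, 1[^N, as an iterated Lebesgue
   integral: the library has no product measure on tuples, and for the
   nonnegative measurable integrands below both coincide by Tonelli. *)
Fixpoint cube_integral (R : realType) (N : nat) : (N.-tuple R -> R) -> R :=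
  match N with
  | 0%N => fun f => f [tuple]
  | N'.+1 => fun f =>
      \int[lebesgue_measure]_(x in `]0, 1[%classic)
        cube_integral (fun t : N'.-tuple R => f (cons_tuple x t))
  end.

Definition jacobi_weight (R : realType) (N : nat) (kappa a b : R)
    (lambda : N.-tuple R) : R :=
  (\prod_(l < N) (tnth lambda l `^ (kappa * a) *
                  (1 - tnth lambda l) `^ (kappa * b))) *
  \prod_(j < N) \prod_(k < N | (j < k)%N)
    `|tnth lambda k - tnth lambda j| `^ (2 * kappa).

Definition jacobi_mean (R : realType) (N : nat) (kappa a b : R)
    (X : N.-tuple R -> R) : R :=
  cube_integral (fun lambda => X lambda * jacobi_weight kappa a b lambda) /
  cube_integral (@jacobi_weight R N kappa a b).

Definition power_sum (R : realType) (N p : nat) (lambda : N.-tuple R) : R :=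
  \sum_(j < N) tnth lambda j ^+ p.

Definition jacobi_cumulant (R : realType) (n : nat) (p : 'I_n -> nat)
    (N : nat) (kappa a b : R) : R :=
  joint_cumulant (@jacobi_mean R N kappa a b) (fun i => @power_sum R N (p i)).

(* The weight is integrable iff the exponents kappa a and kappa b are > -1. *)
Definition jacobi_admissible (R : realType) (N : nat) (kappa a b : R) : Prop :=
  [/\ (0 < N)%N, 0 < kappa, -1 < kappa * a & -1 < kappa * b].

(* f is the rational function whose values are the cumulants.  Agreement is
   only required where f is defined, since even the reduced fraction can be of
   the form 0/0 at an admissible point: for n = 1 and p = 2, this happens when
   N = 1 and kappa (a + b - 1) + 2 = 0.  At most one f satisfies this, because
   the set of admissible parameters is Zariski dense. *)
Definition is_jacobi_mu (R : realType) (n : nat) (p : 'I_n -> nat)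
    (f : param_ratfun R) : Prop :=
  forall (N : nat) (kappa a b r : R), jacobi_admissible N kappa a b ->
    ratfun_value f (param_point N%:R kappa a b) r ->
    r = jacobi_cumulant p N kappa a b.

(* Main.v *)
(* The means of products of power sums satisfy the loop equations obtained from
   the vector fields x^(k+1) (1 - x).  Those attached to the largest part of each
   partition of d express the means of degree d by the means of degree d - 1; the
   determinant of this square system is, as a polynomial in a, of leading term a
   power of kappa a, hence nonzero.  By Cramer's rule the means, and so the
   cumulants, are rational functions.  The loop equations are invariant under
   (N, kappa, a, b) -> (- kappa N, 1 / kappa, - kappa a, - kappa b) when each power
   sum is multiplied by - kappa, so the uniqueness of their solution gives the
   duality of the means; the cumulant of n power sums is homogeneous in them.

   The loop equations are proved without differentiating the weight: substitute
   x + e x^(k+1) (1 - x) for every variable and compare the terms of order e. *)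

Require Import Defs.
From HB Require Import structures.
From mathcomp Require Import all_boot all_order all_algebra fraction.
From mathcomp Require mpoly.
Import (canonicals, coercions) mpoly.
From mathcomp Require Import ring lra.
From mathcomp Require Import all_classical all_reals all_analysis measurable_realfun.

Set Implicit Arguments.
Unset Strict Implicit.
Unset Printing Implicit Defensive.

Import Order.TTheory GRing.Theory Num.Theory.
Import numFieldNormedType.Exports.

Local Open Scope ring_scope.

(** * The loop equations as a linear system *)

(** Exceptional points shape the proof. A determinant of the system may vanish at an admissible
    point, whereas [is_jacobi_mu] asks for agreement wherever some fraction for [f] is defined. So
    linear algebra alone does not suffice: the cumulants are also shown to be right-continuous in
    [a], the direction in which the determinants are nonzero polynomials. On the algebraic side,
    substituting the dual parameters into a fraction makes sense once no nonzero polynomial is sent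
    to 0, that is, once the substitution is injective on polynomials. The system is solved without
    division (adjugates, products of determinants), so that the same formulas can be read over
    numbers, polynomials and rational functions. The vector fields vanish at 0 and 1, so the
    substitution maps the cube to itself and multiplies each x and 1 - x by a factor close to 1.
    Negative exponents of the weight are therefore harmless and no boundary term appears. *)

Definition canon (s : seq nat) : seq nat := sort geq [seq i <- s | (0 < i)%N].

(** The power sum of exponent 0 is the constant [N], so a product of power sums is [N ^+ zeros s]
    times the product indexed by the partition [canon s]. *)
Definition zeros (s : seq nat) : nat := count (pred1 0%N) s.

Lemma perm_canon s : perm_eq s (nseq (zeros s) 0%N ++ canon s).
Proof.
rewrite perm_sym (@perm_trans _ (nseq (zeros s) 0%N ++ [seq i <- s | (0 < i)%N])) //.
  by rewrite perm_cat2l; apply/permPl/perm_sort.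
elim: s => [|[|m] s IH] //=; first by rewrite perm_cons.
by rewrite add0n -cat1s perm_catCA /= perm_cons.
Qed.

Lemma canon_perm s s' : perm_eq s s' -> canon s = canon s'.
Proof.
move=> h; apply/perm_sortP; last exact: perm_filter.
- by move=> m k; rewrite leq_total.
- by move=> m k p; rewrite /geq /= => h1 h2; apply: leq_trans h2 h1.
- by move=> m k; rewrite /geq /= -eqn_leq => /eqP ->.
Qed.

Lemma zeros_perm s s' : perm_eq s s' -> zeros s = zeros s'.
Proof. by move/permP; apply. Qed.

Lemma canon_gt0 s : all (leq 1) (canon s).
Proof. by rewrite all_sort filter_all. Qed.

Lemma canon_idem s : canon (canon s) = canon s.
Proof.
rewrite {1}/canon (all_filterP (canon_gt0 s)) sorted_sort //.
  by move=> m k p; rewrite /geq /= => h1 h2; apply: leq_trans h2 h1.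
by apply: sort_sorted => m k; rewrite leq_total.
Qed.

Lemma canon_cons0 s : canon (0%N :: s) = canon s.
Proof. by []. Qed.

Lemma zeros_canon s : zeros (canon s) = 0%N.
Proof.
apply/eqP; rewrite -leqn0 leqNgt -has_count; apply/hasPn => i /(allP (canon_gt0 s)).
by case: i.
Qed.

Lemma sumn_canon s : sumn (canon s) = sumn s.
Proof.
rewrite (perm_sumn (perm_canon s)) sumn_cat.
by elim: (zeros s).
Qed.

Fixpoint seqs_le (d n : nat) : seq (seq nat) :=
  [::] :: if n is n'.+1 then [seq i :: s | i <- iota 0 d.+1, s <- seqs_le d n'] else [::].

Lemma mem_seqs_le d n s : (size s <= n)%N -> all (geq d) s -> s \in seqs_le d n.
Proof.
elim: n s => [|n IH] [|i s] // hs /andP[hi ha].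
suff h : i :: s \in [seq j :: t | j <- iota 0 d.+1, t <- seqs_le d n].
  by rewrite inE; apply/orP; right.
by apply/allpairsP; exists (i, s); split; rewrite ?IH ?mem_iota.
Qed.

(** A partition of [d] has at most [d] parts, each at most [d], so filtering [seqs_le d d] misses
    none. *)
Definition parts (d : nat) : seq (seq nat) :=
  undup [seq s <- seqs_le d d | (canon s == s) && (sumn s == d)].

Lemma mem_parts d s : (s \in parts d) = (canon s == s) && (sumn s == d).
Proof.
rewrite mem_undup mem_filter andb_idr // => /andP[/eqP hs /eqP hd].
have pos : all (leq 1) s by rewrite -hs canon_gt0.
apply: mem_seqs_le; rewrite -hd.
  elim: s pos {hs hd} => //= i s IH /andP[hi /IH hs].
  by rewrite -add1n leq_add.
elim: s {pos hs hd} => //= i s IH; rewrite leq_addr /=.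
by apply: sub_all IH => j /= hj; rewrite /geq /= (leq_trans hj) ?leq_addl.
Qed.

Lemma parts_uniq d : uniq (parts d).
Proof. exact: undup_uniq. Qed.

Local Notation part d i := (nth [::] (parts d) (i : 'I_(size (parts d)))).

Lemma part_mem d (i : 'I_(size (parts d))) : part d i \in parts d.
Proof. exact: mem_nth. Qed.

Lemma canon_part d (i : 'I_(size (parts d))) : canon (part d i) = part d i.
Proof. by have := part_mem i; rewrite mem_parts => /andP[/eqP]. Qed.

Lemma sumn_part d (i : 'I_(size (parts d))) : sumn (part d i) = d.
Proof. by have := part_mem i; rewrite mem_parts => /andP[_ /eqP]. Qed.

Lemma part_inj d (i j : 'I_(size (parts d))) : (part d i == part d j) = (i == j).
Proof. by rewrite nth_uniq ?parts_uniq. Qed.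

(** Leibniz rule: along the vector field x^(k+1) the power sum of exponent [m] varies by [m] times
    that of exponent [m + k]. *)
Fixpoint join_terms (k : nat) (s : seq nat) : seq (nat * seq nat) :=
  if s is m :: s' then
    (m, (m + k)%N :: s') :: [seq (t.1, m :: t.2) | t <- join_terms k s']
  else [::].

Lemma sumn_join_terms k s t : t \in join_terms k s -> sumn t.2 = (k + sumn s)%N.
Proof.
elim: s t => [|m s IH] t //=; rewrite inE => /orP[/eqP -> /=|].
  by rewrite addnAC addnC addnA addnAC (addnC k).
by case/mapP => u /IH hu -> /=; rewrite hu addnCA.
Qed.

Lemma size_join_terms k s t : t \in join_terms k s -> size t.2 = size s.
Proof.
elim: s t => [|m s IH] t //=; rewrite inE => /orP[/eqP -> //|].
by case/mapP => u /IH hu -> /=; rewrite hu.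
Qed.

Section LoopTerms.
Variable K : comNzRingType.
Implicit Types (c kappa : K) (M : seq nat -> K).

(** Contribution, up to sign, of one monomial x^(k+1) of the vector field. The one-variable factors
    enter through [c], the differences of variables give the double sum, and the observable gives
    [join_terms]. *)
Definition loop_terms c kappa k s : seq (K * seq nat) :=
  (c, k :: s) :: [seq (kappa, [:: i, (k - i)%N & s]) | i <- iota 0 k.+1] ++
  [seq (t.1%:R, t.2) | t <- join_terms k s].

Definition lincomb (T : seq (K * seq nat)) M : K := \sum_(t <- T) t.1 * M t.2.

Lemma lincomb_loop c kappa k s M : lincomb (loop_terms c kappa k s) M =
  c * M (k :: s) + kappa * (\sum_(i < k.+1) M [:: val i, (k - i)%N & s]) +
  \sum_(t <- join_terms k s) t.1%:R * M t.2.
Proof.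
rewrite /lincomb big_cons big_cat !big_map /= addrA; congr (_ + _ + _).
rewrite mulr_sumr -(big_mkord xpredT (fun i => kappa * M [:: i, (k - i)%N & s])).
by rewrite /index_iota subn0.
Qed.

Lemma sumn_loop_terms c kappa k s t :
  t \in loop_terms c kappa k s -> sumn t.2 = (k + sumn s)%N.
Proof.
rewrite inE mem_cat => /or3P[/eqP -> //|/mapP[i]|/mapP[u]].
  by rewrite mem_iota /= add0n ltnS => hi -> /=; rewrite addnA subnKC.
by move=> /sumn_join_terms <- ->.
Qed.

Variables (N kappa a b : K).

(* The loop equation of the head part k + 1 of a partition, in which the moments
   of degree sumn s are expressed by those of degree sumn s - 1.  The first
   coefficient is written so that a occurs only in the summand kappa * a. *)
Definition top_terms (s : seq nat) : seq (K * seq nat) :=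
  if s is k.+1 :: s' then
    loop_terms (kappa * a + (kappa * b + k.+2%:R * (1 - kappa))) kappa k.+1 s'
  else [::].

(** In [k.+1%:R * (1 - kappa)], the 1 comes from the Jacobian of the substitution and [- kappa] from
    the diagonal, which the double sum contains but the product over pairs does not. *)
Definition low_terms (s : seq nat) : seq (K * seq nat) :=
  if s is k.+1 :: s' then
    loop_terms (kappa * a + k.+1%:R * (1 - kappa)) kappa k s'
  else [::].

(* M s stands for the mean of the product of the power sums of exponents in s. *)
Definition loop_solution M : Prop :=
  [/\ M [::] = 1, forall s, M (0%N :: s) = N * M s,
      forall s s', perm_eq s s' -> M s = M s'
    & forall s, canon s = s -> lincomb (top_terms s) M = lincomb (low_terms s) M].

Lemma sumn_top_terms s t : t \in top_terms s -> sumn t.2 = sumn s.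
Proof. by case: s => [|[|k] s] //= /sumn_loop_terms. Qed.

Lemma sumn_low_terms s t : t \in low_terms s -> sumn t.2 = (sumn s).-1.
Proof. by case: s => [|[|k] s] //= /sumn_loop_terms. Qed.

Definition part_coef (T : seq (K * seq nat)) (s : seq nat) : K :=
  \sum_(t <- T | canon t.2 == s) t.1 * N ^+ zeros t.2.

Lemma loop_solution_canon M : loop_solution M ->
  forall s, M s = N ^+ zeros s * M (canon s).
Proof.
case=> _ M0 Mperm _ s; rewrite (Mperm _ _ (perm_canon s)).
by elim: (zeros s) => [|z IH] /=; rewrite ?expr0 ?mul1r // M0 IH exprS mulrA.
Qed.

Lemma lincomb_part_coef M d T : (forall s, M s = N ^+ zeros s * M (canon s)) ->
  (forall t, t \in T -> sumn t.2 = d) ->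
  lincomb T M = \sum_(j < size (parts d)) part_coef T (part d j) * M (part d j).
Proof.
move=> Mcanon hT; under eq_bigr do rewrite mulr_suml.
rewrite /lincomb (exchange_big_dep xpredT) //= [LHS]big_seq [RHS]big_seq.
apply: eq_bigr => t tT; rewrite Mcanon.
have ht : canon t.2 \in parts d by rewrite mem_parts canon_idem sumn_canon hT ?eqxx.
have hi : (index (canon t.2) (parts d) < size (parts d))%N by rewrite index_mem.
rewrite (big_pred1 (Ordinal hi)) /= ?nth_index ?mulrA // => j.
by rewrite /= [RHS]eq_sym -part_inj /= nth_index.
Qed.

Definition loop_top_mx d : 'M[K]_(size (parts d)) :=
  \matrix_(i, j) part_coef (top_terms (part d i)) (part d j).

Definition loop_low_mx d : 'M[K]_(size (parts d.+1), size (parts d)) :=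
  \matrix_(i, j) part_coef (low_terms (part d.+1 i)) (part d j).

(** Cramer's rule without division: this is [loop_den d] times the vector of moments of degree [d].
    In degree 0 the only partition is empty, with moment 1. *)
Fixpoint loop_vec d : 'cV[K]_(size (parts d)) :=
  if d is d'.+1 then \adj (loop_top_mx d'.+1) *m (loop_low_mx d' *m loop_vec d') else const_mx 1.

Fixpoint loop_den d : K := if d is d'.+1 then \det (loop_top_mx d'.+1) * loop_den d' else 1.

(** At most one index satisfies the condition, so the sum picks the entry of [canon s] without
    building an ordinal. *)
Definition loop_num (s : seq nat) : K :=
  N ^+ zeros s * \sum_(j | part (sumn s) j == canon s) loop_vec (sumn s) j 0.

Lemma loop_num_canon s : loop_num s = N ^+ zeros s * loop_num (canon s).
Proof. by rewrite /loop_num zeros_canon expr0 mul1r canon_idem sumn_canon. Qed.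

Lemma loop_num_part d (i : 'I_(size (parts d))) : loop_num (part d i) = loop_vec d i 0.
Proof.
rewrite /loop_num sumn_part canon_part -{1}(canon_part i) zeros_canon mul1r.
by rewrite (big_pred1 i) // => j; rewrite part_inj.
Qed.

Lemma loop_solution_vec M d : loop_solution M ->
  loop_top_mx d.+1 *m (\col_i M (part d.+1 i)) = loop_low_mx d *m (\col_i M (part d i)).
Proof.
move=> solM; have Mc := loop_solution_canon solM; case: solM => _ _ _ eqM.
apply/colP => i; rewrite !mxE.
transitivity (lincomb (top_terms (part d.+1 i)) M).
  rewrite (lincomb_part_coef (d := d.+1)) //; first by apply: eq_bigr => j _; rewrite !mxE.
  by move=> t /sumn_top_terms; rewrite sumn_part.
rewrite eqM ?canon_part // (lincomb_part_coef (d := d)) //.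
  by apply: eq_bigr => j _; rewrite !mxE.
by move=> t /sumn_low_terms; rewrite sumn_part.
Qed.

(** Uniqueness in a form that assumes no determinant to be nonzero; it carries no information where
    [loop_den] vanishes. *)
Lemma den_loop_solution M s : loop_solution M -> loop_den (sumn s) * M s = loop_num s.
Proof.
move=> solM; rewrite loop_num_canon (loop_solution_canon solM) mulrCA; congr (_ * _).
rewrite -(sumn_canon s).
have hc : canon (canon s) = canon s by rewrite canon_idem.
move: (canon s) hc => {}s hc.
suff H d : loop_den d *: (\col_i M (part d i)) = loop_vec d.
  have hs : s \in parts (sumn s) by rewrite mem_parts hc !eqxx.
  have hi : (index s (parts (sumn s)) < size (parts (sumn s)))%N by rewrite index_mem.
  have /colP/(_ (Ordinal hi)) := H (sumn s).
  by rewrite !mxE -loop_num_part /= nth_index.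
elim: d => [|d IH] /=.
  apply/colP => i; rewrite !mxE mul1r; case: i => [[|i] hi] //=.
  by case: solM.
rewrite -IH -!scalemxAr -loop_solution_vec // mulmxA mul_adj_mx.
by rewrite -scalemx1 -scalemxAl mul1mx scalerA mulrC.
Qed.

(** [loop_den] accumulates the determinants of all lower degrees, so one condition at the total
    degree of a cumulant covers every moment in it. *)
Lemma loop_den_neq0_le d e : (e <= d)%N -> loop_den d != 0 -> loop_den e != 0.
Proof.
move=> /subnKC <-; elim: (d - e)%N => [|m IH]; rewrite ?addn0 // addnS /=.
by move=> h; apply: IH; apply: contraNneq h => ->; rewrite mulr0.
Qed.

End LoopTerms.

Section LoopField.
Variable K : fieldType.
Variables (N kappa a b : K).

Definition loop_moment (s : seq nat) : K := loop_num N kappa a b s / loop_den N kappa a b (sumn s).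

Hypothesis den_neq0 : forall d, loop_den N kappa a b d != 0.

(** Existence, the converse of [den_loop_solution]. Duality needs it: at the dual parameters there
    is no ensemble to supply a solution. *)
Lemma loop_momentP : loop_solution N kappa a b loop_moment.
Proof.
have Mc s : loop_moment s = N ^+ zeros s * loop_moment (canon s).
  by rewrite /loop_moment sumn_canon mulrA -loop_num_canon.
have Mperm s s' : perm_eq s s' -> loop_moment s = loop_moment s'.
  by move=> h; rewrite Mc [RHS]Mc (canon_perm h) (zeros_perm h).
split=> //.
- rewrite /loop_moment /loop_num /= invr1 mulr1 mul1r (big_pred1 ord0) ?mxE // => -[[|j] hj] //=.
- by move=> s; rewrite Mc [loop_moment s]Mc [RHS]mulrA canon_cons0 -exprS.
move=> s hs; have [s0|s_gt0] := posnP (sumn s).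
  suff -> : s = [::] by [].
  have := canon_gt0 s; rewrite hs; case: s s0 {hs} => //= i s.
  by case: i.
case def_d: (sumn s) s_gt0 => [|d] // _.
have hsp : s \in parts d.+1 by rewrite mem_parts hs def_d !eqxx.
have hi : (index s (parts d.+1) < size (parts d.+1))%N by rewrite index_mem.
have E : loop_top_mx N kappa a b d.+1 *m (\col_i loop_moment (part d.+1 i)) =
   loop_low_mx N kappa a d *m (\col_i loop_moment (part d i)).
  have colE e : \col_i loop_moment (part e i) = (loop_den N kappa a b e)^-1 *: loop_vec N kappa a b e.
    by apply/colP => i; rewrite !mxE /loop_moment loop_num_part sumn_part mulrC.
  have := den_neq0 d.+1; rewrite !colE -!scalemxAr /= mulf_eq0 negb_or => /andP[h1 h2].
  rewrite mulmxA mul_mx_adj -scalemx1 -scalemxAl mul1mx scalerA; congr (_ *: _).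
  by rewrite invfM mulrAC mulVf ?mul1r.
have /colP/(_ (Ordinal hi)) := E; rewrite !mxE => {}E.
rewrite (lincomb_part_coef (d := d.+1) Mc) => [|t /sumn_top_terms]; last by rewrite def_d.
rewrite (lincomb_part_coef (d := d) Mc) => [|t /sumn_low_terms]; last by rewrite def_d.
transitivity (\sum_j loop_top_mx N kappa a b d.+1 (Ordinal hi) j * (\col_i loop_moment (part d.+1 i)) j 0).
  by apply: eq_bigr => j _; rewrite !mxE /= nth_index.
by rewrite E; apply: eq_bigr => j _; rewrite !mxE /= nth_index.
Qed.

End LoopField.

(** * Compatibility of the linear system with ring morphisms *)

Section LoopMorphism.
Variables (K K' : comNzRingType) (f : {rmorphism K -> K'}) (N kappa a b : K).
Notation N' := (f N).
Notation kappa' := (f kappa).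
Notation a' := (f a).
Notation b' := (f b).

Lemma loop_terms_morph c k s : loop_terms (f c) kappa' k s =
  [seq (f t.1, t.2) | t <- loop_terms c kappa k s].
Proof.
rewrite /loop_terms /= map_cat -!map_comp; congr (_ :: _ :: _).
by congr (_ ++ _); apply: eq_map => t /=; rewrite rmorph_nat.
Qed.

Lemma top_terms_morph s : top_terms kappa' a' b' s =
  [seq (f t.1, t.2) | t <- top_terms kappa a b s].
Proof.
case: s => [|[|k] s] //; rewrite /top_terms -loop_terms_morph.
by rewrite !(rmorph_nat, rmorph1, rmorphD, rmorphN, rmorphM).
Qed.

Lemma low_terms_morph s : low_terms kappa' a' s =
  [seq (f t.1, t.2) | t <- low_terms kappa a s].
Proof.
case: s => [|[|k] s] //; rewrite /low_terms -loop_terms_morph.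
by rewrite !(rmorph_nat, rmorph1, rmorphD, rmorphN, rmorphM).
Qed.

Lemma part_coef_morph T s : part_coef N' [seq (f t.1, t.2) | t <- T] s = f (part_coef N T s).
Proof.
rewrite /part_coef big_map rmorph_sum; apply: eq_bigr => t _ /=.
by rewrite rmorphM rmorphXn.
Qed.

Lemma loop_top_mx_morph d : loop_top_mx N' kappa' a' b' d = map_mx f (loop_top_mx N kappa a b d).
Proof. by apply/matrixP => i j; rewrite !mxE top_terms_morph part_coef_morph. Qed.

Lemma loop_low_mx_morph d : loop_low_mx N' kappa' a' d = map_mx f (loop_low_mx N kappa a d).
Proof. by apply/matrixP => i j; rewrite !mxE low_terms_morph part_coef_morph. Qed.

Lemma loop_den_morph d : loop_den N' kappa' a' b' d = f (loop_den N kappa a b d).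
Proof.
by elim: d => [|d IH] /=; rewrite ?rmorph1 // rmorphM IH loop_top_mx_morph det_map_mx.
Qed.

Lemma loop_vec_morph d : loop_vec N' kappa' a' b' d = map_mx f (loop_vec N kappa a b d).
Proof.
elim: d => [|d IH] /=; first by rewrite map_const_mx rmorph1.
by rewrite IH loop_low_mx_morph loop_top_mx_morph !map_mxM map_mx_adj.
Qed.

Lemma loop_num_morph s : loop_num N' kappa' a' b' s = f (loop_num N kappa a b s).
Proof.
rewrite /loop_num rmorphM rmorphXn rmorph_sum; congr (_ * _).
by apply: eq_bigr => j _; rewrite loop_vec_morph mxE.
Qed.

End LoopMorphism.

Lemma part_coef_cons (K : comNzRingType) (N c : K) s T s' : part_coef N ((c, s) :: T) s' =
  (if canon s == s' then c * N ^+ zeros s else 0) + part_coef N T s'.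
Proof. by rewrite /part_coef big_cons; case: eqP; rewrite ?add0r. Qed.

(* Hence the determinant of the system has leading term (kappa * a) ^ size as a
   polynomial in a. *)
Lemma loop_top_mx_split (K : comNzRingType) (N kappa a b : K) d :
  loop_top_mx N kappa a b d.+1 = (kappa * a)%:M + loop_top_mx N kappa 0 b d.+1.
Proof.
apply/matrixP => i j; rewrite !mxE.
have hs := canon_part i; have hd := sumn_part i.
have z0 : zeros (part d.+1 i) = 0%N by rewrite -hs zeros_canon.
case E: (part d.+1 i) => [|[|k] s] //; first by rewrite E in hd.
  by rewrite E in z0.
(* The parameter [a] occurs only in the coefficient of the head term, whose exponents form the
   partition itself: a diagonal entry. *)
rewrite /top_terms /loop_terms !part_coef_cons -E hs part_inj z0 mulr0 add0r expr0 !mulr1.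
by case: eqP => _; rewrite ?mulr1n ?mulr0n ?addrA // !add0r.
Qed.

(** Each determinant is a power of [kappa] times a characteristic polynomial, which is monic. *)
Lemma loop_den_poly_neq0 (F : fieldType) (N kappa b : F) d : kappa != 0 ->
  loop_den N%:P kappa%:P 'X b%:P d != 0.
Proof.
move=> k0; elim: d => [|d IH] /=; first exact: oner_neq0.
rewrite mulf_neq0 //.
pose B := loop_top_mx N kappa 0 b d.+1.
have -> : loop_top_mx N%:P kappa%:P 'X b%:P d.+1 = kappa%:P *: char_poly_mx (- kappa^-1 *: B).
  rewrite loop_top_mx_split -polyC0 loop_top_mx_morph -/B /char_poly_mx scalerDr scale_scalar_mx.
  congr (_ + _); apply/matrixP => i j; rewrite !mxE mulNr !polyCN opprK polyCM mulrA -polyCM.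
  by rewrite divff // polyC1 mul1r.
rewrite detZ mulf_neq0 // ?expf_neq0 ?polyC_eq0 //.
exact: monic_neq0 (char_poly_monic _).
Qed.

Section Duality.
Variable K : fieldType.
Variables (N kappa a b : K).
Hypothesis kappa0 : kappa != 0.

(** The three kinds of terms in [loop_terms] are products of [size s] plus 1, 2 and 0 power sums.
    Once [(- kappa) ^- size s] is factored out, the rescaling divides [c] by [- kappa], divides
    [kappa] by its square, and leaves the last kind alone: this is the system at the dual
    parameters. *)
Lemma loop_solution_dual M :
  loop_solution (- kappa * N) kappa^-1 (- kappa * a) (- kappa * b) M ->
  loop_solution N kappa a b (fun s => (- kappa) ^- size s * M s).
Proof.
have nk0 : - kappa != 0 by rewrite oppr_eq0.
case=> M1 M0 Mperm eqM; split.
- by rewrite invr1 mul1r.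
- move=> s /=; rewrite M0 exprS; field; rewrite expf_neq0 // nk0.
- by move=> s s' h; rewrite (perm_size h) (Mperm _ _ h).
have side c c' k s : c = - kappa * c' ->
  lincomb (loop_terms c kappa k s) (fun s => (- kappa) ^- size s * M s) =
  (- kappa) ^- (size s) * lincomb (loop_terms c' kappa^-1 k s) M.
  move=> ->; rewrite !lincomb_loop !mulrDr; congr (_ + _ + _).
  - by rewrite /= exprS invfM; field; rewrite expf_neq0 // ?nk0 ?kappa0.
  - rewrite !mulr_sumr; apply: eq_bigr => i _ /=.
    by rewrite !exprS !invfM; field; rewrite expf_neq0 // ?nk0 ?kappa0.
  rewrite mulr_sumr; apply: eq_big_seq => t /size_join_terms ->.
  by rewrite mulrCA.
move=> [|[|k] s] hs //; have := eqM _ hs; rewrite /top_terms /low_terms => E.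
rewrite (side _ (kappa^-1 * (- kappa * a) +
        (kappa^-1 * (- kappa * b) + k.+2%:R * (1 - kappa^-1)))); last by field.
by rewrite E -(side (kappa * a + k.+1%:R * (1 - kappa))) //; field.
Qed.
End Duality.

(** * Rational functions of the parameters *)

Section RatEval.
Variables (A : idomainType) (L : fieldType) (e : {rmorphism A -> L}).
Implicit Types (f g : {fraction A}) (r s : L).

(** [ratfun_value] for an arbitrary morphism into a field, so that substituting the dual parameters,
    a morphism into rational functions, is an evaluation too. *)
Definition frac_eval f r : Prop := exists P Q : A,
  [/\ f = FracField.tofrac P / FracField.tofrac Q, e Q != 0 & r = e P / e Q].

Lemma frac_eval_denom_neq0 (Q : A) : e Q != 0 -> FracField.tofrac Q != 0.
Proof. by rewrite tofrac_eq0; apply: contraNneq => ->; rewrite rmorph0. Qed.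

Lemma frac_eval_unique f r s : frac_eval f r -> frac_eval f s -> r = s.
Proof.
move=> [P [Q [-> Q0 ->]]] [P' [Q' [E Q'0 ->]]].
have := E => /eqP; rewrite eqr_div ?frac_eval_denom_neq0 //.
rewrite -!rmorphM /= tofrac_eq => /eqP {}E.
by apply/eqP; rewrite eqr_div // -!rmorphM E.
Qed.

Lemma frac_eval_tofrac P : frac_eval (FracField.tofrac P) (e P).
Proof. by exists P, 1; rewrite !rmorph1 !divr1 oner_neq0. Qed.

Lemma frac_evalD f g r s : frac_eval f r -> frac_eval g s -> frac_eval (f + g) (r + s).
Proof.
move=> [P [Q [-> Q0 ->]]] [P' [Q' [-> Q'0 ->]]].
exists (P * Q' + P' * Q), (Q * Q'); rewrite !rmorphD !rmorphM.
by rewrite mulf_neq0 // !addf_div ?frac_eval_denom_neq0.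
Qed.

Lemma frac_evalM f g r s : frac_eval f r -> frac_eval g s -> frac_eval (f * g) (r * s).
Proof.
move=> [P [Q [-> Q0 ->]]] [P' [Q' [-> Q'0 ->]]].
by exists (P * P'), (Q * Q'); rewrite !rmorphM mulf_neq0 // !mulf_div.
Qed.

Lemma frac_evalN f r : frac_eval f r -> frac_eval (- f) (- r).
Proof. by move=> [P [Q [-> Q0 ->]]]; exists (- P), Q; rewrite !rmorphN !mulNr. Qed.

Lemma frac_evalV f r : frac_eval f r -> r != 0 -> frac_eval f^-1 r^-1.
Proof.
move=> [P [Q [-> Q0 ->]]]; rewrite mulf_eq0 invr_eq0 negb_or => /andP[P0 _].
by exists Q, P; rewrite !invf_div.
Qed.

Lemma frac_evalX f r m : frac_eval f r -> frac_eval (f ^+ m) (r ^+ m).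
Proof.
move=> h; elim: m => [|m IH]; last by rewrite !exprS; apply: frac_evalM.
by have := frac_eval_tofrac 1; rewrite !rmorph1.
Qed.

Lemma frac_repr f : f = FracField.tofrac (frac (repr f)).1 / FracField.tofrac (frac (repr f)).2.
Proof.
apply/eqP; rewrite eq_sym -(inj_eq (mulIf (_ : FracField.tofrac (frac (repr f)).2 != 0)));
  last by rewrite tofrac_eq0 denom_ratioP.
rewrite mulfVK ?tofrac_eq0 ?denom_ratioP //.
set x := repr f; rewrite -[f]reprK -/x; unlock FracField.tofrac.
rewrite -[X in _ == X]FracField.pi_mul /FracField.mulf /=.
rewrite !numden_Ratio ?oner_neq0 // mulr1; apply/eqP/eqmodP => /=.
by rewrite FracField.equivfE !numden_Ratio ?oner_neq0 ?denom_ratioP // ?mulr1 mul1r.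
Qed.

(** An injective morphism sends no denominator to 0, so the fraction chosen by [repr] can be
    evaluated. *)
Lemma frac_eval_repr f : injective e ->
  frac_eval f (e (frac (repr f)).1 / e (frac (repr f)).2).
Proof.
move=> e_inj; exists (frac (repr f)).1, (frac (repr f)).2; split=> //.
  exact: frac_repr.
by rewrite raddf_eq0 // denom_ratioP.
Qed.

End RatEval.

Section ZariskiDensity.
Variables (F : numFieldType) (n : nat).

Lemma radix_lt (B n0 : nat) (f : nat -> nat) : (forall i, (i < n0)%N -> (f i < B)%N) ->
  (\sum_(i < n0) f i * B ^ i < B ^ n0)%N.
Proof.
elim: n0 => [|k IH] hf; first by rewrite big_ord0.
rewrite big_ord_recr /= expnS.
have h1 := IH (fun i hi => hf i (ltnW hi)).
apply: (@leq_trans (B ^ k + f k * B ^ k)); first by rewrite ltn_add2r.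
by rewrite -mulSn leq_mul2r hf ?orbT.
Qed.

Lemma radix_inj (B n0 : nat) (f g : nat -> nat) :
  (forall i, (i < n0)%N -> (f i < B)%N) -> (forall i, (i < n0)%N -> (g i < B)%N) ->
  (\sum_(i < n0) f i * B ^ i = \sum_(i < n0) g i * B ^ i)%N ->
  forall i, (i < n0)%N -> f i = g i.
Proof.
elim: n0 => [|k IH] // hf hg; rewrite !big_ord_recr /= => E.
have hf' i (hi : (i < k)%N) := hf i (ltnW hi).
have hg' i (hi : (i < k)%N) := hg i (ltnW hi).
have B0 : (0 < B ^ k)%N by apply: leq_ltn_trans (radix_lt hf').
have E1 : f k = g k.
  move: E; rewrite addnC [RHS]addnC => /(congr1 (fun x => x %/ B ^ k)%N).
  by rewrite !divnMDl // !divn_small ?radix_lt ?addn0.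
move: E; rewrite E1 => /addIn E i; rewrite ltnS leq_eqVlt => /orP[/eqP -> //|].
exact: IH E i.
Qed.

(* Kronecker substitution: with B larger than all exponents, the values
   m ^ (B ^ i) of the variables send distinct monomials to distinct powers of m. *)
Lemma mpoly_eq0_grid (p : mpoly.mpoly n F) :
  (forall v, (forall i, exists m, v i = m.+1%:R) -> mpoly.meval v p = 0) -> p = 0.
Proof.
move=> hp; pose B := (\max_(m <- mpoly.msupp p) mpoly.mdeg m).+1.
pose e (m : mpoly.multinom n) := (\sum_(i < n) m i * B ^ i)%N.
have e_inj : {in mpoly.msupp p &, injective e}.
  move=> m m' hm hm' E; apply/mpoly.mnmP => i.
  pose ext (m0 : mpoly.multinom n) j := if insub j is Some j' then m0 j' else 0%N.
  have extE m0 (j : 'I_n) : ext m0 j = m0 j by rewrite /ext valK.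
  have ext_lt m0 : m0 \in mpoly.msupp p -> forall j, (j < n)%N -> (ext m0 j < B)%N.
    move=> h j hj; rewrite (extE m0 (Ordinal hj)).
    rewrite ltnS; apply: leq_trans (leq_bigmax_seq _ h isT).
    by rewrite mpoly.mdegE (bigD1 (Ordinal hj)) //= leq_addr.
  rewrite -(extE m) -(extE m'); apply: (radix_inj (ext_lt _ hm) (ext_lt _ hm')) => //.
  by rewrite (eq_bigr _ (fun j _ => congr1 (muln^~ _) (extE m j))) -/(e m) E;
    apply: eq_bigr => j _; rewrite extE.
pose q : {poly F} := \sum_(m <- mpoly.msupp p) mpoly.mcoeff m p *: 'X^(e m).
have q0 : q = 0.
  (* [q] is [p] along the curve. It has the distinct roots 1, ..., [size q], more than the degree of
     a nonzero polynomial of this size allows. *)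
  apply: (@roots_geq_poly_eq0 _ q [seq k.+1%:R | k <- iota 0 (size q)]).
  - apply/allP => x /mapP[k _ ->]; apply/eqP; rewrite /q horner_sum.
    transitivity (mpoly.meval (fun i : 'I_n => k.+1%:R ^+ (B ^ i)) p); last apply: hp.
      rewrite mpoly.mevalE; apply: eq_bigr => m _; rewrite hornerZ hornerXn; congr (_ * _).
      rewrite /e -prodrXr; apply: eq_bigr => i _.
      by rewrite -exprM mulnC.
    by move=> i; exists (k.+1 ^ (B ^ i)).-1%N; rewrite prednK ?expn_gt0 // natrX.
  - rewrite map_inj_uniq ?iota_uniq // => x y /eqP.
    by rewrite eqr_nat => /eqP [].
  - by rewrite size_map size_iota.
apply/mpoly.mpolyP => m; rewrite mpoly.mcoeff0.
have [hm|hm] := boolP (m \in mpoly.msupp p); last exact: mpoly.memN_msupp_eq0.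
have := congr1 (fun r : {poly F} => r`_(e m)) q0.
rewrite coef0 coef_sum (bigD1_seq m) ?mpoly.msupp_uniq //= coefZ coefXn eqxx mulr1.
rewrite big_seq_cond big1 ?addr0 // => m' /andP[hm' nm].
rewrite coefZ coefXn; case: eqP => [/e_inj E|]; last by rewrite mulr0.
by rewrite E ?eqxx // in nm.
Qed.

End ZariskiDensity.

(** * Cumulants as polynomials in the moments *)

Section Cumulant.
Variable n : nat.
Implicit Types (p : 'I_n -> nat).

(** [joint_cumulant] with the means abstracted into a function of the exponents, so that it applies
    to rational functions, where no expectation exists. *)
Definition cumulant (K : comNzRingType) (M : seq nat -> K) p : K :=
  \sum_(P : {set {set 'I_n}} | finset.partition P [set: 'I_n])
    (-1) ^+ (#|P|.-1) * ((#|P|.-1)`!)%:R *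
    \prod_(B in P) M [seq p i | i <- enum B].

(** The blocks of a set partition have [n] elements in all, so every summand is rescaled by the same
    power. *)
Lemma cumulant_scale (K : comNzRingType) (M : seq nat -> K) c p :
  cumulant (fun s => c ^+ size s * M s) p = c ^+ n * cumulant M p.
Proof.
rewrite /cumulant mulr_sumr; apply: eq_bigr => P partP.
rewrite big_split /= [RHS]mulrCA; congr (_ * (_ * _)).
rewrite prodrXr; congr (_ ^+ _).
under eq_bigr do rewrite size_map -cardE.
by rewrite -(card_partition partP) cardsT card_ord.
Qed.

Lemma eq_cumulant (K : comNzRingType) (M M' : seq nat -> K) p :
  (forall s, (sumn s <= \sum_i p i)%N -> M s = M' s) -> cumulant M p = cumulant M' p.
Proof.
move=> h; apply: eq_bigr => P _; congr (_ * _); apply: eq_bigr => B _; apply: h.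
by rewrite sumnE big_map big_enum /= [leqRHS](bigID (mem B)) leq_addr.
Qed.

Lemma frac_eval_cumulant (A : idomainType) (L : fieldType) (e : {rmorphism A -> L})
    (M : seq nat -> {fraction A}) (M' : seq nat -> L) p :
  (forall s, (sumn s <= \sum_i p i)%N -> frac_eval e (M s) (M' s)) ->
  frac_eval e (cumulant M p) (cumulant M' p).
Proof.
move=> h; have e1 : frac_eval e 1 1.
  by have := frac_eval_tofrac e 1; rewrite !rmorph1.
have e0 : frac_eval e 0 0.
  by have := frac_eval_tofrac e 0; rewrite !rmorph0.
apply: (big_ind2 (frac_eval e)) => //; first by move=> *; apply: frac_evalD.
move=> P _; apply: frac_evalM; last first.
  apply: (big_ind2 (frac_eval e)) => //; first by move=> *; apply: frac_evalM.
  move=> B _; apply: h.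
  by rewrite sumnE big_map big_enum /= [leqRHS](bigID (mem B)) leq_addr.
have := frac_eval_tofrac e ((-1) ^+ (#|P|.-1) * ((#|P|.-1)`!)%:R).
by rewrite !rmorphM !rmorphXn !rmorphN !rmorph1 !rmorph_nat.
Qed.

End Cumulant.

(** * Moments and their duality as rational functions of the parameters *)

Section Params.
Variable F : numFieldType.
Notation A := (param_poly F).
Notation K := (param_ratfun F).

Definition pvar (i : nat) : A := mpoly.mpolyX F (mpoly.mnm1 (inord i)).

Definition pnum := loop_num (pvar 0) (pvar 1) (pvar 2) (pvar 3).
Definition pden := loop_den (pvar 0) (pvar 1) (pvar 2) (pvar 3).

Lemma param_pointE (T : Type) (N kappa a b : T) :
  ((param_point N kappa a b (inord 0) = N) * (param_point N kappa a b (inord 1) = kappa) *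
  (param_point N kappa a b (inord 2) = a) * (param_point N kappa a b (inord 3) = b))%type.
Proof. by rewrite /param_point !(tnth_nth N) !inordK. Qed.

Lemma meval_pvar (v : 'I_4 -> F) i : mpoly.meval v (pvar i) = v (inord i).
Proof. by rewrite mpoly.mevalXU. Qed.

Lemma meval_pnum N kappa a b s :
  mpoly.meval (param_point N kappa a b) (pnum s) = loop_num N kappa a b s.
Proof. by rewrite -(loop_num_morph (mpoly.meval _)) /= !meval_pvar !param_pointE. Qed.

Lemma meval_pden N kappa a b d :
  mpoly.meval (param_point N kappa a b) (pden d) = loop_den N kappa a b d.
Proof. by rewrite -(loop_den_morph (mpoly.meval _)) /= !meval_pvar !param_pointE. Qed.

(** One nonzero specialisation suffices: 1 for [N], [kappa] and [b], with [a] kept as the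
    indeterminate. *)
Lemma pden_neq0 d : pden d != 0.
Proof.
pose h := param_point 1%:P 1%:P 'X 1%:P : 'I_4 -> {poly F}.
apply: contraNneq (loop_den_poly_neq0 (1 : F) 1 d (oner_neq0 F)) => h0.
have := congr1 (mpoly.mmap (@polyC F) h) h0; rewrite raddf0 -(loop_den_morph (mpoly.mmap (@polyC F) h)).
by rewrite /pvar /= !mpoly.mmapX !mpoly.mmap1U /h !param_pointE => ->.
Qed.

Definition sub_morph (h : 'I_4 -> K) : {rmorphism A -> K} :=
  mpoly.mmap (@FracField.tofrac A \o @mpoly.mpolyC 4 F) h.

Lemma sub_pvar (h : 'I_4 -> K) i : sub_morph h (pvar i) = h (inord i).
Proof. by rewrite /sub_morph /pvar /= mpoly.mmapX mpoly.mmap1U. Qed.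

Lemma frac_eval_sub (h : 'I_4 -> K) (v w : 'I_4 -> F) (P : A) :
  (forall i, frac_eval (mpoly.meval v) (h i) (w i)) ->
  frac_eval (mpoly.meval v) (sub_morph h P) (mpoly.meval w P).
Proof.
move=> hw; rewrite mpoly.mevalE /sub_morph /= /mpoly.mmap.
have e0 : frac_eval (mpoly.meval v) 0 0.
  by have := frac_eval_tofrac (mpoly.meval v) 0; rewrite !rmorph0.
have e1 : frac_eval (mpoly.meval v) 1 1.
  by have := frac_eval_tofrac (mpoly.meval v) 1; rewrite !rmorph1.
apply: (big_ind2 (frac_eval (mpoly.meval v))) => //.
  by move=> *; apply: frac_evalD.
move=> m _; apply: frac_evalM.
  have := frac_eval_tofrac (mpoly.meval v) (mpoly.mpolyC 4 (mpoly.mcoeff m P)).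
  by rewrite /= mpoly.mevalC.
apply: (big_ind2 (frac_eval (mpoly.meval v))) => //.
  by move=> *; apply: frac_evalM.
by move=> i _; apply: frac_evalX.
Qed.

Lemma forall_ord4 (T : 'I_4 -> Prop) :
  T (inord 0) -> T (inord 1) -> T (inord 2) -> T (inord 3) -> forall i, T i.
Proof.
move=> h0 h1 h2 h3 i; rewrite -(inord_val i).
by case: i => [[|[|[|[|i]]]] hi].
Qed.

Definition dual_point := param_point (- varK F * varN F) (varK F)^-1
  (- varK F * varA F) (- varK F * varB F).

Lemma frac_eval_dual (N kappa a b : F) (P : A) : kappa != 0 ->
  frac_eval (mpoly.meval (param_point N kappa a b)) (sub_morph dual_point P)
    (mpoly.meval (param_point (- kappa * N) kappa^-1 (- kappa * a) (- kappa * b)) P).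
Proof.
move=> k0; pose v := param_point N kappa a b.
have ev i : frac_eval (mpoly.meval v) (param_var F (inord i)) (v (inord i)).
  by rewrite -meval_pvar; apply: frac_eval_tofrac.
have eK : frac_eval (mpoly.meval v) (varK F) kappa.
  by have := ev 1; rewrite /v param_pointE.
apply: frac_eval_sub; apply: forall_ord4; rewrite /dual_point !param_pointE.
- by apply: frac_evalM; [exact: frac_evalN|have := ev 0; rewrite /v param_pointE].
- exact: frac_evalV.
- by apply: frac_evalM; [exact: frac_evalN|have := ev 2; rewrite /v param_pointE].
- by apply: frac_evalM; [exact: frac_evalN|have := ev 3; rewrite /v param_pointE].
Qed.

(* The substitution is an involution on the points with kappa != 0. *)
Lemma dual_morph_inj : injective (sub_morph dual_point).
Proof.
apply: raddf_inj => P P0; apply: mpoly_eq0_grid => w hw.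
pose N := w (inord 0); pose kappa := w (inord 1).
pose a := w (inord 2); pose b := w (inord 3).
have k0 : kappa != 0 by rewrite /kappa; have [m ->] := hw (inord 1); rewrite pnatr_eq0.
(* The dual of the dual of [w] is [w], so the value of [P] at [w] is that of its image, which is 0,
   at the dual point. *)
have := @frac_eval_dual (- kappa * N) kappa^-1 (- kappa * a) (- kappa * b) P.
rewrite invr_eq0 invrK => /(_ k0).
rewrite P0 => /frac_eval_unique/(_ (frac_eval_tofrac _ 0)).
rewrite rmorph0 => E; rewrite -[RHS]E; apply: mpoly.meval_eq.
apply: forall_ord4; rewrite param_pointE //.
- by rewrite -/N; field.
- by rewrite -/a; field.
- by rewrite -/b; field.
Qed.

(** [ratfun_subst] evaluates the fraction chosen by [repr]; as values are unique, any other fraction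
    for [f] may be used to compute it. *)
Lemma ratfun_subst_dual (f g : K) : frac_eval (sub_morph dual_point) f g ->
  ratfun_subst f (- varK F * varN F) (varK F)^-1 (- varK F * varA F) (- varK F * varB F) = g.
Proof.
move=> hg; apply: frac_eval_unique hg.
exact: frac_eval_repr dual_morph_inj.
Qed.

Lemma varE : ((FracField.tofrac (pvar 0) = varN F) * (FracField.tofrac (pvar 1) = varK F) *
 (FracField.tofrac (pvar 2) = varA F) * (FracField.tofrac (pvar 3) = varB F))%type.
Proof. by []. Qed.

Definition ratmu (s : seq nat) : K := loop_moment (varN F) (varK F) (varA F) (varB F) s.

Lemma ratmuE s : ratmu s = FracField.tofrac (pnum s) / FracField.tofrac (pden (sumn s)).
Proof.
rewrite /ratmu /loop_moment -!varE.
by rewrite (loop_num_morph (@FracField.tofrac A)) (loop_den_morph (@FracField.tofrac A)).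
Qed.

Lemma ratmu_dual s : frac_eval (sub_morph dual_point) (ratmu s)
  (loop_moment (- varK F * varN F) (varK F)^-1 (- varK F * varA F) (- varK F * varB F) s).
Proof.
rewrite ratmuE; exists (pnum s), (pden (sumn s)); split=> //.
  by rewrite raddf_eq0 ?pden_neq0 //; apply: dual_morph_inj.
by rewrite /pnum /pden -(loop_num_morph (sub_morph dual_point))
  -(loop_den_morph (sub_morph dual_point)) !sub_pvar /dual_point !param_pointE.
Qed.

Lemma varK_neq0 : varK F != 0.
Proof.
rewrite -!varE tofrac_eq0; apply/eqP => h.
have := congr1 (mpoly.meval (param_point 1 1 1 1)) h.
by rewrite meval_pvar param_pointE rmorph0 => /eqP; rewrite oner_eq0.
Qed.

Lemma ratmu_duality s : ratmu s = (- varK F) ^- size s *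
  loop_moment (- varK F * varN F) (varK F)^-1 (- varK F * varA F) (- varK F * varB F) s.
Proof.
(* The dual determinants are the images of nonzero polynomials under an injective morphism. *)
have den0 d : loop_den (- varK F * varN F) (varK F)^-1 (- varK F * varA F) (- varK F * varB F) d != 0.
  suff -> : loop_den (- varK F * varN F) (varK F)^-1 (- varK F * varA F) (- varK F * varB F) d
      = sub_morph dual_point (pden d).
    by rewrite raddf_eq0 ?pden_neq0 //; apply: dual_morph_inj.
  by rewrite /pden -(loop_den_morph (sub_morph dual_point)) !sub_pvar /dual_point !param_pointE.
have den0' : loop_den (varN F) (varK F) (varA F) (varB F) (sumn s) != 0.
  by rewrite -!varE (loop_den_morph (@FracField.tofrac A)) tofrac_eq0 pden_neq0.
have E := den_loop_solution s (loop_solution_dual varK_neq0 (loop_momentP den0)).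
by rewrite /ratmu {1}/loop_moment -E mulrC mulKf.
Qed.

Section RatCumulant.
Variables (n : nat) (p : 'I_n -> nat).

Lemma ratcum_duality : cumulant ratmu p = (- varK F) ^- n *
  ratfun_subst (cumulant ratmu p) (- varK F * varN F) (varK F)^-1
    (- varK F * varA F) (- varK F * varB F).
Proof.
rewrite -exprVn (ratfun_subst_dual (frac_eval_cumulant (fun s _ => ratmu_dual s))).
rewrite -cumulant_scale; apply: eq_cumulant => s _.
by rewrite exprVn ratmu_duality.
Qed.

Lemma ratmu_eval N kappa a b (M : seq nat -> F) s : loop_solution N kappa a b M ->
  loop_den N kappa a b (sumn s) != 0 ->
  frac_eval (mpoly.meval (param_point N kappa a b)) (ratmu s) (M s).
Proof.
move=> solM d0; rewrite ratmuE; exists (pnum s), (pden (sumn s)).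
rewrite /= meval_pden meval_pnum; split=> //.
by rewrite -(den_loop_solution s solM) mulrC mulKf.
Qed.

Lemma ratcum_eval N kappa a b (M : seq nat -> F) : loop_solution N kappa a b M ->
  loop_den N kappa a b (\sum_i p i) != 0 ->
  frac_eval (mpoly.meval (param_point N kappa a b)) (cumulant ratmu p) (cumulant M p).
Proof.
move=> solM d0; apply: frac_eval_cumulant => s hs; apply: ratmu_eval => //.
exact: loop_den_neq0_le hs d0.
Qed.

End RatCumulant.

Lemma ratfun_eq_grid (f g : K) :
  (forall N kappa a b r s, frac_eval (mpoly.meval (param_point N.+1%:R kappa.+1%:R a.+1%:R b.+1%:R)) f r ->
     frac_eval (mpoly.meval (param_point N.+1%:R kappa.+1%:R a.+1%:R b.+1%:R)) g s -> r = s) ->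
  f = g.
Proof.
move=> h; rewrite (frac_repr f) (frac_repr g).
have := frac_repr f; have := frac_repr g.
have := denom_ratioP (repr f); have := denom_ratioP (repr g).
move: (frac (repr f)) (frac (repr g)) => [P Q] [P' Q'] /= Q'0 Q0 Eg Ef.
apply/eqP; rewrite eqr_div ?tofrac_eq0 // -!rmorphM tofrac_eq -subr_eq0.
(* Multiplied by both denominators, the cross difference vanishes also at the grid points where one
   of them is 0. *)
rewrite -(mulIr_eq0 _ (mulIf (mulf_neq0 Q0 Q'0))); apply/eqP.
apply: mpoly_eq0_grid => v hv.
have [N EN] := hv (inord 0); have [kappa Ek] := hv (inord 1).
have [a Ea] := hv (inord 2); have [b Eb] := hv (inord 3).
have Ev : v =1 param_point N.+1%:R kappa.+1%:R a.+1%:R b.+1%:R.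
  by apply: forall_ord4; rewrite param_pointE.
rewrite (mpoly.meval_eq _ Ev) !rmorphM rmorphB !rmorphM /=.
move: (h N kappa a b); set e := mpoly.meval _ => {}h.
have [->|eQ] := eqVneq (e Q) 0; first by rewrite mul0r mulr0.
have [->|eQ'] := eqVneq (e Q') 0; first by rewrite !mulr0.
have /eqP := h _ _ (ex_intro _ P (ex_intro _ Q (And3 Ef eQ erefl)))
  (ex_intro _ P' (ex_intro _ Q' (And3 Eg eQ' erefl))).
by rewrite eqr_div // => /eqP ->; rewrite subrr mul0r.
Qed.

(** Being a nonzero polynomial in the shift [h], the determinant is nonzero for all small [h > 0],
    even if it vanishes at 0. *)
Lemma loop_den_shift (N kappa a b : F) d : kappa != 0 ->
  exists2 q : {poly F}, q != 0 & forall h, loop_den N kappa (a + h) b d = q.[h].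
Proof.
move=> k0; pose q := loop_den N%:P kappa%:P 'X b%:P d.
exists (q \Po ('X + a%:P)).
  have -> : 'X + a%:P = 'X - (- a)%:P by rewrite polyCN opprK.
  by rewrite comp_poly2_eq0 ?size_XsubC // loop_den_poly_neq0.
move=> h; rewrite horner_comp !hornerE.
rewrite -[q.[_]]/(horner_eval (h + a) q) -(loop_den_morph (horner_eval (h + a))) /=.
by rewrite /horner_eval !hornerE addrC.
Qed.

End Params.

(** * Iterated integrals over the unit cube *)

Section ParamIntegral.
Context {R : realType}.
Notation mu := (@lebesgue_measure R).
Local Open Scope classical_set_scope.
Local Open Scope ring_scope.

(** No integrability is assumed: the integral is [fine] of the difference of the integrals of the
    positive and negative parts, each measurable by Tonelli. *)
Lemma measurable_fun_Rintegral_param d (T : measurableType d) (D : set (measurableTypeR R))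
    (g : T * measurableTypeR R -> R) : measurable D ->
  measurable_fun setT g ->
  measurable_fun setT (fun t : T => \int[mu]_(x in D) g (t, x)).
Proof.
move=> mD mg.
have H (h : T * measurableTypeR R -> \bar R) : measurable_fun setT h -> (forall z, 0 <= h z)%E ->
    measurable_fun setT (fun t : T => \int[mu]_x h (t, x))%E.
  exact: measurable_fun_fubini_tonelli_F.
have mgD : measurable_fun setT (fun z : T * measurableTypeR R => (g z * \1_D z.2)%:E).
  apply/measurable_EFinP; apply: measurable_funM => //.
  by apply: measurableT_comp => //; exact: measurable_indic.
rewrite /Rintegral.
apply: (@measurableT_comp _ _ _ _ _ _ fine) => //.
have E t : (\int[mu]_(x in D) (g (t, x))%:E =
   \int[mu]_x (fun z : T * measurableTypeR R => (g z * \1_D z.2)%:E)^\+ (t, x) -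
   \int[mu]_x (fun z : T * measurableTypeR R => (g z * \1_D z.2)%:E)^\- (t, x))%E.
  rewrite integral_mkcond integralE.
  congr (_ - _)%E; apply: eq_integral => x _.
    rewrite !funeposE /patch; case: ifPn => xD /=; rewrite indicE.
      by rewrite xD mulr1.
    by rewrite (negbTE xD) mulr0.
  rewrite !funenegE /patch; case: ifPn => xD /=; rewrite indicE.
    by rewrite xD mulr1.
  by rewrite (negbTE xD) mulr0.
under eq_fun do rewrite E.
by apply: emeasurable_funB; apply: H => //; [exact: measurable_funepos|exact: measurable_funeneg].
Qed.

(** In the induction each integration variable in turn joins the parameter space, hence the general
    type [T]. *)
Lemma measurable_fun_cube_integral N d (T : measurableType d)
    (f : T * N.-tuple (measurableTypeR R) -> R) : measurable_fun setT f ->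
  measurable_fun setT (fun t => cube_integral (fun s : N.-tuple R => f (t, s))).
Proof.
elim: N d T f => [|N IH] d T f mf /=.
  apply: (@measurableT_comp _ _ _ _ _ _ f) => //.
pose g (z : T * measurableTypeR R) := cube_integral (fun s : N.-tuple R => f (z.1, cons_tuple z.2 s)).
apply: (measurable_fun_Rintegral_param (g := g)) => //.
apply: (IH _ _
  (fun w : (T * measurableTypeR R) * N.-tuple (measurableTypeR R) => f (w.1.1, cons_tuple w.1.2 w.2))).
apply: (@measurableT_comp _ _ _ _ _ _ f) => //.
apply: measurable_fun_pair; first exact: (measurableT_comp measurable_fst measurable_fst).
apply: measurable_cons => //.
exact: (measurableT_comp measurable_snd measurable_fst).
Qed.

End ParamIntegral.

Section CubeIntegral.
Context {R : realType}.
Notation mu := (@lebesgue_measure R).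
Notation RR := (measurableTypeR R).
Local Open Scope classical_set_scope.
Local Open Scope ring_scope.

Definition in_cube N (t : N.-tuple R) : bool := all (fun x => 0 < x < 1) t.

Lemma in_cube_cons N x (t : N.-tuple R) :
  in_cube (cons_tuple x t) = (0 < x < 1) && in_cube t.
Proof. by []. Qed.

Lemma eq_cube_integral N (f g : N.-tuple R -> R) :
  (forall t, in_cube t -> f t = g t) -> cube_integral f = cube_integral g.
Proof.
elim: N f g => [|N IH] f g fg /=; first exact: fg.
apply: eq_Rintegral => x /set_mem /=; rewrite in_itv /= => x01.
by apply: IH => t ht; apply: fg; rewrite in_cube_cons x01.
Qed.

Lemma cube_integral_ge0 N (f : N.-tuple R -> R) :
  (forall t, in_cube t -> 0 <= f t) -> 0 <= cube_integral f.
Proof.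
elim: N f => [|N IH] f f0 /=; first exact: f0.
apply: Rintegral_ge0 => x /=; rewrite in_itv /= => x01.
by apply: IH => t ht; apply: f0; rewrite in_cube_cons x01.
Qed.

(* u is an integrable majorant of each variable; it replaces an integrability
   predicate on the cube, which would need a product measure. *)
Variable u : R -> R.
Hypothesis u_ge0 : forall x, 0 <= u x.
Hypothesis u_int : mu.-integrable `]0, 1[ (EFin \o u).

Definition cube_dom N (f : N.-tuple R -> R) : Prop :=
  measurable_fun setT (f : N.-tuple RR -> R) /\
  exists2 C, 0 <= C & forall t, in_cube t -> `|f t| <= C * \prod_(x <- t) u x.

Let U := \int[mu]_(x in `]0, 1[) u x.

Lemma measurable_slice N (f : N.+1.-tuple RR -> R) x : measurable_fun setT f ->
  measurable_fun setT (fun t : N.-tuple RR => f (cons_tuple x t)).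
Proof.
move=> mf; apply: (@measurableT_comp _ _ _ _ _ _ f) => //.
by apply: measurable_cons => //; exact: measurable_cst.
Qed.

Lemma measurable_slice_integral N (f : N.+1.-tuple RR -> R) : measurable_fun setT f ->
  measurable_fun setT (fun x : RR => cube_integral (fun t : N.-tuple R => f (cons_tuple x t))).
Proof.
move=> mf.
apply: (measurable_fun_cube_integral (f := fun z : RR * N.-tuple RR => f (cons_tuple z.1 z.2))).
apply: (@measurableT_comp _ _ _ _ _ _ f) => //.
exact: measurable_cons.
Qed.

Lemma slice_integrable N (f : N.+1.-tuple RR -> R) B : measurable_fun setT f ->
  (forall x, 0 < x < 1 ->
    `|cube_integral (fun t : N.-tuple R => f (cons_tuple x t))| <= B * u x) ->
  mu.-integrable `]0, 1[ (EFin \o (fun x => B * u x)) /\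
  mu.-integrable `]0, 1[
    (EFin \o (fun x => cube_integral (fun t : N.-tuple R => f (cons_tuple x t)))).
Proof.
move=> mf fB.
have mD : measurable (`]0, 1[ : set RR) by exact: measurable_itv.
have iB : mu.-integrable `]0, 1[ (EFin \o (fun x => B * u x)).
  rewrite (_ : _ \o _ = (fun x => B%:E * (u x)%:E))%E; last first.
    by apply/funext => x /=; rewrite EFinM.
  exact: integrableZl.
split=> //; apply: le_integrable iB => //.
  by apply/measurable_EFinP; apply: measurable_funTS; exact: measurable_slice_integral.
move=> x /=; rewrite in_itv /= => x01; rewrite lee_fin.
by rewrite (le_trans (fB _ x01)) // ler_norm.
Qed.

Lemma cube_dom_bound N (f : N.-tuple R -> R) C : 0 <= C ->
  measurable_fun setT (f : N.-tuple RR -> R) ->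
  (forall t, in_cube t -> `|f t| <= C * \prod_(x <- t) u x) ->
  `|cube_integral f| <= C * U ^+ N.
Proof.
elim: N f C => [|N IH] f C C0 mf fC /=.
  by have := fC [tuple] isT; rewrite big_nil expr0.
have bnd x : 0 < x < 1 ->
    `|cube_integral (fun t : N.-tuple R => f (cons_tuple x t))| <= C * U ^+ N * u x.
  move=> x01; rewrite mulrAC; apply: IH.
  - by rewrite mulr_ge0.
  - exact: measurable_slice.
  by move=> t ht; have := fC (cons_tuple x t); rewrite in_cube_cons x01 big_cons mulrA; apply.
have mD : measurable (`]0, 1[ : set RR) by exact: measurable_itv.
have [iB iI] := slice_integrable mf bnd.
apply: le_trans (le_normr_Rintegral _ iI) _ => //.
apply: le_trans (_ : \int[mu]_(x in `]0, 1[) (C * U ^+ N * u x) <= _); last first.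
  by rewrite RintegralZl // exprSr mulrA.
apply: le_Rintegral => //.
by have := integrable_norm iI.
Qed.

Lemma cube_dom_slice N (f : N.+1.-tuple R -> R) x : cube_dom f -> 0 < x < 1 ->
  cube_dom (fun t : N.-tuple R => f (cons_tuple x t)).
Proof.
move=> [mf [C C0 fC]] x01; split; first exact: measurable_slice.
exists (C * u x) => [|t ht]; first exact: mulr_ge0.
by have := fC (cons_tuple x t); rewrite in_cube_cons x01 big_cons mulrA; apply.
Qed.

Lemma cube_dom_integrable N (f : N.+1.-tuple R -> R) : cube_dom f ->
  mu.-integrable `]0, 1[
    (EFin \o (fun x => cube_integral (fun t : N.-tuple R => f (cons_tuple x t)))).
Proof.
move=> [mf [C C0 fC]].
have [//|_ //] := slice_integrable (B := C * U ^+ N) mf _ => x x01.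
rewrite mulrAC; apply: cube_dom_bound.
- by rewrite mulr_ge0.
- exact: measurable_slice.
by move=> t ht; have := fC (cons_tuple x t); rewrite in_cube_cons x01 big_cons mulrA; apply.
Qed.

Lemma cube_domD N (f g : N.-tuple R -> R) : cube_dom f -> cube_dom g ->
  cube_dom (fun t => f t + g t).
Proof.
move=> [mf [C C0 fC]] [mg [D D0 gD]]; split; first exact: measurable_funD.
exists (C + D) => [|t ht]; first exact: addr_ge0.
by rewrite mulrDl (le_trans (ler_normD _ _)) // lerD ?fC ?gD.
Qed.

Lemma cube_domM N (f g : N.-tuple R -> R) B : cube_dom f ->
  measurable_fun setT (g : N.-tuple RR -> R) ->
  (forall t, in_cube t -> `|g t| <= B) -> cube_dom (fun t => g t * f t).
Proof.
move=> [mf [C C0 fC]] mg gB; split; first exact: measurable_funM.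
exists (`|B| * C) => [|t ht]; first exact: mulr_ge0.
rewrite normrM -mulrA ler_pM ?fC //.
by rewrite (le_trans (gB t ht)) // ler_norm.
Qed.

Lemma cube_domZ N (f : N.-tuple R -> R) c : cube_dom f -> cube_dom (fun t => c * f t).
Proof.
by move=> df; apply: (cube_domM (g := cst c) (B := `|c|) df) => //; exact: measurable_cst.
Qed.

Lemma cube_integralD N (f g : N.-tuple R -> R) : cube_dom f -> cube_dom g ->
  cube_integral (fun t => f t + g t) = cube_integral f + cube_integral g.
Proof.
elim: N f g => [|N IH] f g df dg //=.
rewrite -RintegralD ?measurable_itv //; [|exact: cube_dom_integrable..].
apply: eq_Rintegral => x /set_mem /=; rewrite in_itv /= => x01.
by apply: (IH (fun t => f (cons_tuple x t)) (fun t => g (cons_tuple x t)));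
  exact: cube_dom_slice.
Qed.

Lemma cube_integralZ N (f : N.-tuple R -> R) c : cube_dom f ->
  cube_integral (fun t => c * f t) = c * cube_integral f.
Proof.
elim: N f => [|N IH] f df //=.
rewrite -RintegralZl ?measurable_itv //; last exact: cube_dom_integrable.
apply: eq_Rintegral => x /set_mem /=; rewrite in_itv /= => x01.
by apply: (IH (fun t => f (cons_tuple x t))); exact: cube_dom_slice.
Qed.

Lemma cube_integralB N (f g : N.-tuple R -> R) : cube_dom f -> cube_dom g ->
  cube_integral (fun t => f t - g t) = cube_integral f - cube_integral g.
Proof.
move=> df dg; rewrite -mulN1r -cube_integralZ // -cube_integralD //.
  by apply: eq_cube_integral => t _; rewrite mulN1r.
exact: cube_domZ.
Qed.

Lemma le_cube_integral N (f g : N.-tuple R -> R) : cube_dom f -> cube_dom g ->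
  (forall t, in_cube t -> f t <= g t) -> cube_integral f <= cube_integral g.
Proof.
move=> df dg fg; rewrite -subr_ge0 -cube_integralB //.
by apply: cube_integral_ge0 => t ht; rewrite subr_ge0 fg.
Qed.

Lemma cube_dom0 N : cube_dom (fun _ : N.-tuple R => 0).
Proof.
split; first exact: measurable_cst.
by exists 0 => // t _; rewrite normr0 mul0r.
Qed.

Lemma cube_integral0 N : cube_integral (fun _ : N.-tuple R => 0) = 0 :> R.
Proof.
by have := cube_integralZ 0 (cube_dom0 N); rewrite !mul0r.
Qed.

Lemma cube_dom_sum N (I : Type) (r : seq I) (F : I -> N.-tuple R -> R) :
  (forall i, cube_dom (F i)) -> cube_dom (fun t => \sum_(i <- r) F i t).
Proof.
move=> dF; elim: r => [|i r IH].
  by rewrite (_ : (fun _ => _) = (fun=> 0)); [exact: cube_dom0|apply/funext => t; rewrite big_nil].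
rewrite (_ : (fun _ => _) = (fun t => F i t + \sum_(j <- r) F j t)).
  exact: cube_domD.
by apply/funext => t; rewrite big_cons.
Qed.

Lemma cube_integral_sum N (I : Type) (r : seq I) (F : I -> N.-tuple R -> R) :
  (forall i, cube_dom (F i)) ->
  cube_integral (fun t => \sum_(i <- r) F i t) = \sum_(i <- r) cube_integral (F i).
Proof.
move=> dF; elim: r => [|i r IH].
  by rewrite big_nil -[RHS](cube_integral0 N); apply: eq_cube_integral => t _; rewrite big_nil.
rewrite big_cons -IH -cube_integralD //; last exact: cube_dom_sum.
by apply: eq_cube_integral => t _; rewrite big_cons.
Qed.

(** Positivity is asked only on a box, because the weight vanishes where two variables coincide. *)
Lemma cube_integral_gt0 N (f : N.-tuple R -> R) (a b : nat -> R) : cube_dom f ->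
  (forall t, in_cube t -> 0 <= f t) ->
  (forall i, (i < N)%N -> [/\ 0 <= a i, a i < b i & b i <= 1]) ->
  (forall t, (forall i, a (val i) < tnth t i < b (val i)) -> 0 < f t) ->
  0 < cube_integral f.
Proof.
elim: N f a b => [|N IH] f a b df f0 ab fab /=.
  by apply: fab => -[].
have [a0 ab0 b1] := ab 0%N isT.
pose F x := cube_integral (fun t : N.-tuple R => f (cons_tuple x t)).
have F0 x : 0 < x < 1 -> 0 <= F x.
  by move=> x01; apply: cube_integral_ge0 => t ht; apply: f0; rewrite in_cube_cons x01.
have Fgt0 x : a 0%N < x < b 0%N -> 0 < F x.
  move=> /andP[ax xb]; have x01 : 0 < x < 1 by rewrite (le_lt_trans a0) // (lt_le_trans xb).
  apply: (IH _ (a \o succn) (b \o succn)) => //.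
  - exact: cube_dom_slice.
  - by move=> t ht; apply: f0; rewrite in_cube_cons x01.
  - by move=> i hi; exact: ab.
  move=> t ht; apply: fab => i; case: (unliftP ord0 i) => [j ->|->].
    by rewrite tnthS; exact: ht.
  by rewrite tnth0 ax.
have iF : mu.-integrable `]0, 1[ (EFin \o F) by exact: cube_dom_integrable.
rewrite lt_neqAle Rintegral_ge0 ?andbT; last first.
  by move=> x /=; rewrite in_itv; exact: F0.
(* A zero integral would make [F] vanish almost everywhere, yet [F] is positive on an interval of
   positive length. *)
apply/negP => /eqP/esym I0.
have mD : measurable (`]0, 1[ : set RR) by exact: measurable_itv.
have mF : measurable_fun (`]0, 1[ : set RR) (EFin \o F) by exact: measurable_int iF.
have : (\int[mu]_(x in `]0%R, 1%R[) `|(EFin \o F) x| = 0)%E.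
  transitivity (\int[mu]_(x in `]0%R, 1%R[) (F x)%:E)%E.
    apply: eq_integral => x /set_mem /=; rewrite in_itv /= => /F0 h.
    by rewrite ger0_norm.
  by rewrite -[LHS]fineK; [congr EFin; exact: I0|exact: integrable_fin_num].
move/(ae_eq_integral_abs _ mD mF) => ae0.
have /negligibleP : mu.-negligible (`]a 0%N, b 0%N[ : set RR).
  apply: negligibleS ae0 => x /=; rewrite in_itv /= => abx H.
  have /andP[ax xb] := abx.
  have x01 : x \in `]0, 1[ by rewrite in_itv /= (le_lt_trans a0) // (lt_le_trans xb).
  have [] := H x01; move=> E.
  by have := Fgt0 x abx; rewrite E ltxx.
rewrite /= => /(_ (measurable_itv _)).
rewrite lebesgue_measure_itv /= lte_fin ab0 -EFinD => -[] /eqP.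
by rewrite subr_eq0 => /eqP E; rewrite E ltxx in ab0.
Qed.

Section Substitution.
Variables (phi g : RR -> R) (G K : R).
Hypothesis m_phi : measurable_fun setT phi.
Hypothesis m_g : measurable_fun setT g.
Hypothesis phi01 : forall x, 0 < x < 1 -> 0 < phi x < 1.
Hypothesis gG : forall x, 0 < x < 1 -> 0 <= g x <= G.
Hypothesis uK : forall x, 0 < x < 1 -> u (phi x) <= K * u x.
Hypothesis subst : forall f : RR -> R, measurable_fun setT f ->
  \int[mu]_(x in `]0, 1[) f x = \int[mu]_(x in `]0, 1[) (f (phi x) * g x).

Let pull N (f : N.-tuple R -> R) := fun t : N.-tuple R =>
  f (map_tuple phi t) * \prod_(x <- t) g x.

Lemma measurable_map_tuple N :
  measurable_fun setT (fun t : N.-tuple RR => map_tuple phi t : N.-tuple RR).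
Proof.
apply/measurable_fun_tnthP => i.
rewrite (_ : _ \o _ = phi \o (fun t : N.-tuple RR => tnth t i)).
  by apply: measurableT_comp => //; exact: measurable_tnth.
by apply/funext => t /=; rewrite tnth_map.
Qed.

Lemma measurable_prod_tnth N (h : RR -> R) : measurable_fun setT h ->
  measurable_fun setT (fun t : N.-tuple RR => \prod_(x <- t) h x).
Proof.
move=> mh; rewrite (_ : (fun _ => _) = (fun t : N.-tuple RR => \prod_(i < N) h (tnth t i))).
  apply: measurable_prod => i _.
  by apply: (@measurableT_comp _ _ _ _ _ _ h) => //; exact: measurable_tnth.
by apply/funext => t; rewrite big_tuple.
Qed.

Lemma in_cube_map N (t : N.-tuple R) : in_cube t -> in_cube (map_tuple phi t).
Proof.
by rewrite /in_cube all_map; apply: sub_all => x; exact: phi01.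
Qed.

(** By [uK] and [gG], each variable costs at most a factor |K| G in the majorant. *)
Lemma cube_dom_pull N (f : N.-tuple R -> R) : cube_dom f -> cube_dom (pull f).
Proof.
move=> [mf [C C0 fC]]; split.
  apply: measurable_funM; last exact: measurable_prod_tnth.
  by apply: (@measurableT_comp _ _ _ _ _ _ f) => //; exact: measurable_map_tuple.
(* Only serves to get [0 <= G] from [gG] at some point. *)
have x01 : 0 < (2^-1 : R) < 1 by rewrite invr_gt0 ltr0n invf_lt1 ?ltr0n // ltr1n.
have G0 : 0 <= G by have /andP[] := gG x01; exact: le_trans.
exists (C * (`|K| * G) ^+ N) => [|t ht].
  by rewrite mulr_ge0 // exprn_ge0 // mulr_ge0.
rewrite /pull normrM; apply: le_trans (ler_pM _ _ (fC _ (in_cube_map ht)) (lexx _)) _ => //.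
rewrite -!mulrA ler_wpM2l // big_map /=.
have -> : (`|K| * G) ^+ N = \prod_(x <- t) (`|K| * G).
  by rewrite big_const_seq count_predT size_tuple -Monoid.iteropE /= .
rewrite normr_prod -!big_split /= big_seq [leRHS]big_seq.
apply: ler_prod => x xt; have := allP ht _ xt => hx.
rewrite mulr_ge0 //= (_ : `|K| * G * u x = (`|K| * u x) * G) ?ler_pM //; last by ring.
  by rewrite (le_trans (uK hx)) // ler_wpM2r // ler_norm.
by have /andP[? ?] := gG hx; rewrite ger0_norm.
Qed.

(** One variable at a time: the outer integral by [subst], the inner ones by induction, after which
    [g x] moves under the inner integral. *)
Lemma cube_integral_subst N (f : N.-tuple R -> R) : cube_dom f ->
  cube_integral f = cube_integral (pull f).
Proof.
elim: N f => [|N IH] f df.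
  rewrite /= /pull /= big_nil mulr1; congr f; exact: val_inj.
rewrite /= subst; last by case: df => mf _; exact: measurable_slice_integral.
apply: eq_Rintegral => x /set_mem /=; rewrite in_itv /= => x01.
have px01 := phi01 x01.
rewrite (IH (fun t => f (cons_tuple (phi x) t))); last exact: cube_dom_slice.
rewrite mulrC -cube_integralZ; last first.
  by apply: (cube_dom_pull (f := fun t => f (cons_tuple (phi x) t))); exact: cube_dom_slice.
apply: eq_cube_integral => t _; rewrite /pull /= big_cons mulrCA; congr (f _ * _).
exact: val_inj.
Qed.

End Substitution.

End CubeIntegral.

(** * Polynomial changes of variable *)

Section Density.
Context d (T : measurableType d) {R : realType}.
Variables (mu : {measure set T -> \bar R}) (g : T -> R).
Hypothesis m_g : measurable_fun [set: T] g.
Hypothesis g_ge0 : forall x, 0 <= g x.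
Local Open Scope classical_set_scope.
Local Open Scope ereal_scope.

Definition density_measure (A : set T) : \bar R := \int[mu]_(x in A) (g x)%:E.

Let density0 : density_measure set0 = 0.
Proof. by rewrite /density_measure integral_set0. Qed.

Let density_ge0 A : 0 <= density_measure A.
Proof. by apply: integral_ge0 => x _; rewrite lee_fin. Qed.

Let density_sigma_additive : semi_sigma_additive density_measure.
Proof.
by apply: semi_sigma_additive_nng_induced; [exact/measurable_EFinP|move=> x; rewrite lee_fin].
Qed.

HB.instance Definition _ := isMeasure.Build _ _ _ density_measure
  density0 density_ge0 density_sigma_additive.

Definition density : {measure set T -> \bar R} := density_measure.

Import HBNNSimple.

(** True for simple functions by the definition of the density measure, then for [f] by monotone
    convergence on both sides. *)
Lemma ge0_integral_density (D : set T) (f : T -> \bar R) :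
  measurable D -> measurable_fun D f -> (forall x, 0 <= f x) ->
  \int[density_measure]_(x in D) f x = \int[mu]_(x in D) (f x * (g x)%:E).
Proof.
move=> mD mf f0; pose h := nnsfun_approx mD mf.
have mg D' : measurable_fun D' (EFin \o g).
  by apply/measurable_EFinP; exact: measurable_funTS.
have -> : \int[density_measure]_(x in D) f x =
    lim (\int[density_measure]_(x in D) (EFin \o h n) x @[n --> \oo]).
  have fE x : D x -> f x = lim ((EFin \o h n) x @[n --> \oo]).
    by move=> Dx; apply/esym/cvg_lim => //; exact: cvg_nnsfun_approx.
  under eq_integral => x /[!inE] /fE -> //.
  apply: monotone_convergence => //.
  - move=> n; apply/measurable_EFinP.
    by apply: (measurable_funS measurableT) => //; exact/measurable_funP.
  - by move=> n x Dx //=; rewrite lee_fin.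
  - by move=> x Dx a b ab; rewrite lee_fin; exact/lefP/nd_nnsfun_approx.
have -> : \int[mu]_(x in D) (f x * (g x)%:E) =
    lim (\int[mu]_(x in D) ((EFin \o h n) x * (g x)%:E) @[n --> \oo]).
  have fE x : D x -> f x * (g x)%:E = lim (((EFin \o h n) x * (g x)%:E) @[n --> \oo]).
    by move=> Dx; apply/esym/cvg_lim => //; apply: cvgeZr => //; exact: cvg_nnsfun_approx.
  under eq_integral => x /[!inE] /fE -> //.
  apply: monotone_convergence => //.
  - move=> n; apply: emeasurable_funM => //; apply: measurable_funTS.
    exact/measurable_EFinP.
  - by move=> n x Dx /=; rewrite mule_ge0 ?lee_fin.
  - by move=> x Dx a b ab/=; rewrite lee_wpmul2r ?lee_fin//; exact/lefP/nd_nnsfun_approx.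
suff suf n : \int[density_measure]_(x in D) (EFin \o h n) x =
    \int[mu]_(x in D) ((EFin \o h n) x * (g x)%:E).
  by under eq_fun do rewrite suf.
transitivity (\int[density_measure]_(x in D)
   (\sum_(y \in range (h n)) (y * \1_(h n @^-1` [set y]) x)%:E)).
  by apply: eq_integral => t tD; rewrite /= fimfunE -fsumEFin.
have indich m r : measurable_fun D (fun x => (r * \1_(h m @^-1` [set r]) x)%:E).
  by apply: (measurable_comp measurableT) => //; exact: measurable_funM.
rewrite ge0_integral_fsum//; last by move=> m y Dy; exact: nnfun_muleindic_ge0.
transitivity (\int[mu]_(x in D) (\sum_(y \in range (h n))
    (y * \1_(h n @^-1` [set y]) x)%:E * (g x)%:E)); last first.
  apply: eq_integral => x xD.
  rewrite -ge0_mule_fsuml => [|y]; last exact: nnfun_muleindic_ge0.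
  by rewrite fsumEFin // -(fimfunE _ x).
rewrite ge0_integral_fsum//; last 2 first.
  - by move=> y; apply: emeasurable_funM.
  - by move=> m y Dy; apply: mule_ge0; [exact: nnfun_muleindic_ge0|rewrite lee_fin].
apply: eq_fsbigr => r rhn.
rewrite integralZl_indic_nnsfun => //.
under [RHS]eq_integral do rewrite EFinM -muleA.
rewrite ge0_integralZl//.
- rewrite integral_indic// setIC /= /density_measure; congr (_ * _).
  under [RHS]eq_integral do rewrite muleC.
  rewrite integral_mkcondr; apply: eq_integral => x xD.
  by rewrite epatch_indic.
- by apply: emeasurable_funM => //; exact/measurable_EFinP.
- by move=> t Dt; rewrite mule_ge0 ?lee_fin.
- by move: rhn; rewrite inE => -[t _ <-]; rewrite lee_fin.
Qed.

End Density.

Section PolySubstitution.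
Context {R : realType}.
Notation mu := (@lebesgue_measure R).
Notation RR := (measurableTypeR R).
Local Open Scope classical_set_scope.
Local Open Scope ring_scope.

Lemma measurable_horner (p : {poly R}) (D : set RR) : measurable_fun D (horner p : RR -> R).
Proof.
apply: measurable_funTS; apply: continuous_measurable_fun; exact: continuous_horner.
Qed.

Lemma integral_deriv_poly (p : {poly R}) (x y : R) : x <= y ->
  (\int[mu]_(t in `]x, y]) (p^`().[t])%:E = (p.[y] - p.[x])%:E)%E.
Proof.
rewrite le_eqVlt => /predU1P[->|xy].
  by rewrite set_itvoc0 integral_set0 subrr.
rewrite integral_itv_obnd_cbnd; last by apply/measurable_EFinP; exact: measurable_horner.
rewrite (continuous_FTC2 (F := horner p)) //.
- by apply: continuous_subspaceT; exact: continuous_horner.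
- split; first by move=> t _; exact: derivable_horner.
    by apply: cvg_at_right_filter; exact: continuous_horner.
  by apply: cvg_at_left_filter; exact: continuous_horner.
- by move=> t _; rewrite derivE.
Qed.

Variable p : {poly R}.
Hypothesis p0 : p.[0] = 0.
Hypothesis p1 : p.[1] = 1.
Hypothesis p_incr : forall x y, 0 <= x -> x < y -> y <= 1 -> p.[x] < p.[y].
Hypothesis p_deriv : forall x, 0 <= x <= 1 -> 0 <= p^`().[x].

(** Half-open, to fit the intervals on which the two measures are compared. *)
Let D : set RR := `]0, 1].
Let g : RR -> R := (horner p^`()) \_ D.

Let mD : measurable D. Proof. exact: measurable_itv. Qed.

Let m_g : measurable_fun setT g.
Proof. by apply/(measurable_restrictT _ mD); exact: measurable_horner. Qed.

Let g_ge0 x : 0 <= g x.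
Proof.
rewrite /g /patch; case: ifPn => // /set_mem; rewrite /D /= in_itv /= => /andP[/ltW x0 x1].
by apply: p_deriv; rewrite x0.
Qed.

Let gE x : (g x)%:E = ((fun t => (p^`().[t])%:E) \_ D) x.
Proof. by rewrite /g /patch; case: ifP. Qed.

Let m_p : measurable_fun setT (horner p : RR -> RR).
Proof. exact: measurable_horner. Qed.

Let p_inj x y : 0 <= x <= 1 -> 0 <= y <= 1 -> (p.[x] < p.[y]) = (x < y).
Proof.
move=> /andP[x0 x1] /andP[y0 y1]; apply/idP/idP => [|xy]; last exact: p_incr.
apply: contraTT; rewrite -!leNgt le_eqVlt => /predU1P[->//|yx].
by apply/ltW/p_incr.
Qed.

Let p_surj y : 0 <= y <= 1 -> exists2 x, 0 <= x <= 1 & p.[x] = y.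
Proof.
move=> y01; have [||x] := @IVT R (horner p) 0 1 y ler01.
- by apply: continuous_subspaceT; exact: continuous_horner.
- by rewrite p0 p1 /Num.min /Num.max ltr01.
by rewrite in_itv /= => x01 px; exists x.
Qed.

(** The interval is cut down to one inside ]0, 1]. As [p] is an increasing bijection of [0, 1], the
    preimage is again half-open, and its density measure is an increment of [p], that is, the length
    of the image. *)
Let poly_measure_ocitv (A : set RR) : ocitv A ->
  mu (A `&` D) = density mu m_g g_ge0 (horner p @^-1` A).
Proof.
case=> -[a b] _ <- /=.
rewrite /density /= /density_measure; under eq_integral do rewrite gE.
rewrite -integral_mkcondr.
pose a' := Num.max a 0; pose b' := Num.min b 1.
have AD : `]a, b] `&` D = `]a', b']%classic.
  apply/seteqP; split=> x /=; rewrite /D /= !in_itv /= gt_max le_min.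
    by move=> [/andP[-> ->] /andP[-> ->]].
  by move=> /andP[/andP[-> ->] /andP[-> ->]].
have [ab|ba] := ltP a' b'; last first.
  rewrite AD set_itv_ge ?bnd_simp -?leNgt // measure0.
  rewrite [X in (\int[mu]_(x in X) _)%E](_ : _ = set0) ?integral_set0 //.
  apply/seteqP; split=> x //= []; rewrite /D /= !in_itv /= => /andP[h1 h2] /andP[x0 x1].
  have : a' < p.[x] by rewrite gt_max h1 -p0 p_incr.
  have : p.[x] <= b'.
    rewrite le_min h2 -p1 /=; move: x1; rewrite le_eqVlt => /predU1P[-> //|x1].
    by rewrite ltW // p_incr // ltW.
  by move=> h3 h4; have := lt_le_trans h4 h3; rewrite ltNge ba.
have a'01 : 0 <= a' <= 1.
  by rewrite le_max lexx orbT (le_trans (ltW ab)) // ge_min lexx orbT.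
have b'01 : 0 <= b' <= 1.
  by rewrite (le_trans _ (ltW ab)) ?ge_min ?lexx ?orbT //; case/andP: a'01.
have [al al01 pal] := p_surj a'01; have [be be01 pbe] := p_surj b'01.
have alb : al < be by rewrite -p_inj // pal pbe.
have -> : horner p @^-1` `]a, b] `&` D = `]al, be]%classic.
  have in01 x : 0 < x <= 1 -> (a < p.[x] <= b) = (al < x <= be).
    move=> x01; have x01' : 0 <= x <= 1 by case/andP: x01 => /ltW -> ->.
    have px0 : 0 < p.[x] by rewrite -p0; case/andP: x01 => *; apply: p_incr.
    have px1 : p.[x] <= 1.
      rewrite -p1; case/andP: x01 => x0; rewrite le_eqVlt => /predU1P[-> //|x1].
      by rewrite ltW // p_incr // ltW.
    rewrite [x <= be]leNgt -(p_inj be01 x01') -(p_inj al01 x01') pal pbe -leNgt.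
    by rewrite gt_max le_min px0 px1 !andbT.
  apply/seteqP; split=> x /=; rewrite /D /= !in_itv /=.
    by move=> [h1 h2]; rewrite -in01.
  move=> h; have x01 : 0 < x <= 1.
    case/andP: h => h1 h2; case/andP: al01 => h3 _; case/andP: be01 => _ h4.
    by rewrite (le_lt_trans h3) // (le_trans h2).
  by split=> //; rewrite in01.
rewrite AD integral_deriv_poly ?(ltW alb) // pal pbe.
by rewrite lebesgue_measure_itv /= lte_fin ab -EFinB.
Qed.

(** Uniqueness of measures: half-open intervals generate the Borel sets and are stable under
    intersection. *)
Let poly_measure (A : set RR) : measurable A ->
  mu (A `&` D) = density mu m_g g_ge0 (horner p @^-1` A).
Proof.
move=> mA.
have [m2 m2E] : exists m2 : {measure set RR -> \bar R},
    m2 = pushforward (density mu m_g g_ge0) (horner p : RR -> RR) :> (set RR -> \bar R).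
  unshelve eexists (pushforward (density mu m_g g_ge0) (horner p : RR -> RR)); [exact: m_p|by []].
rewrite -[RHS]/(pushforward (density mu m_g g_ge0) (horner p : RR -> RR) A) -m2E.
apply: (@measure_unique _ _ RR (@ocitv R) (fun k => `]- k%:R, k%:R]%classic) _ _ _ _ (mrestr mu mD)) => //.
- exact: ocitvI.
- by move=> k; exists (- k%:R, k%:R).
- exact: (bigcup_itvT false false).
- by move=> B mB; rewrite m2E; exact: poly_measure_ocitv.
- move=> k; apply: (@le_lt_trans _ _ (mu D)); first exact: measureIr.
  by rewrite lebesgue_measure_itv /= lte_fin ltr01 -EFinD ltry.
Qed.

Lemma ge0_integral_poly_subst (f : RR -> \bar R) : measurable_fun setT f ->
  (forall x, 0 <= f x)%E ->
  (\int[mu]_(x in `]0%R, 1%R]) f x = \int[mu]_(x in `]0%R, 1%R]) (f p.[x] * (p^`().[x])%:E))%E.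
Proof.
move=> mf f0.
transitivity (\int[pushforward (density mu m_g g_ge0) (horner p : RR -> RR)]_(x in D) f x)%E.
  apply: eq_measure_integral => A mA AD.
  by rewrite -[RHS]poly_measure // setIidl.
have mpD : measurable (horner p @^-1` D : set RR).
  by rewrite -[X in measurable X]setTI; exact: m_p.
rewrite (ge0_integral_pushforward m_p) //; last exact: measurable_funTS.
rewrite ge0_integral_density //; last 2 first.
- by apply: measurable_funTS; apply: measurableT_comp.
- by move=> x /=.
rewrite [LHS]integral_mkcond [RHS]integral_mkcond; apply: eq_integral => x _.
rewrite /g /patch /= -/D; case: (boolP (x \in D)) => [xD|_]; last by rewrite mule0; case: ifP.
suff -> : (x \in (horner p @^-1` D : set RR)) = true by [].
apply/mem_set; rewrite /D /= in_itv /=.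
move: xD => /set_mem; rewrite /D /= in_itv /= => /andP[x0 x1].
rewrite -p0 -p1 p_incr //=; move: x1; rewrite le_eqVlt => /predU1P[-> //|x1].
by rewrite ltW // p_incr // ltW.
Qed.

Lemma Rintegral_poly_subst (f : RR -> R) : measurable_fun setT f ->
  \int[mu]_(x in `]0, 1[) f x = \int[mu]_(x in `]0, 1[) (f p.[x] * p^`().[x]).
Proof.
move=> mf.
have mfp : measurable_fun setT (fun x : RR => f p.[x] * p^`().[x]).
  apply: measurable_funM; last exact: measurable_horner.
  by apply: (@measurableT_comp _ _ _ _ _ _ f).
rewrite /Rintegral; congr fine.
(* Adding the endpoint 1 changes neither integral. *)
rewrite integral_itv_bndo_bndc; last by apply/measurable_EFinP; exact: measurable_funTS.
rewrite integral_itv_bndo_bndc; last by apply/measurable_EFinP; exact: measurable_funTS.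
have mfE : measurable_fun setT (EFin \o f) by exact/measurable_EFinP.
(* The derivative of [p] is nonnegative on the interval, so multiplying by it commutes with taking
   positive and negative parts. *)
rewrite integralE [RHS]integralE; congr (_ - _)%E.
  rewrite ge0_integral_poly_subst //; last exact: measurable_funepos.
  apply: eq_integral => x /set_mem /=; rewrite in_itv /= => /andP[/ltW x0 x1].
  rewrite !funeposE /= -!EFin_max -EFinM maxr_pMl ?mul0r //.
  by apply: p_deriv; rewrite x0.
rewrite ge0_integral_poly_subst //; last exact: measurable_funeneg.
apply: eq_integral => x /set_mem /=; rewrite in_itv /= => /andP[/ltW x0 x1].
rewrite !funenegE /= -!EFin_max -EFinM maxr_pMl ?mul0r ?mulNr //.
by apply: p_deriv; rewrite x0.
Qed.

End PolySubstitution.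

(** * Integrability of the one-variable Jacobi weight *)

Section BetaWeight.
Context {R : realType}.
Notation mu := (@lebesgue_measure R).
Notation RR := (measurableTypeR R).
Local Open Scope classical_set_scope.
Local Open Scope ring_scope.

Definition beta_weight (al be x : R) : R := x `^ al * (1 - x) `^ be.

Lemma beta_weight_ge0 al be x : 0 <= beta_weight al be x.
Proof. by rewrite mulr_ge0 // powR_ge0. Qed.

Lemma measurable_beta_weight al be : measurable_fun setT (beta_weight al be : RR -> R).
Proof.
apply: measurable_funM; first exact: measurable_powR.
apply: (@measurableT_comp _ _ _ _ _ _ (fun x : RR => x `^ be)); first exact: measurable_powR.
by apply: measurable_funB => //; exact: measurable_cst.
Qed.

(** Exhaustion by compact intervals: on each of them the integral is an increment of [H], at most
    [M + M], and the bound passes to the limit. *)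
Lemma ge0_integral_antideriv_lty (h H : R -> R) (M : R) :
  (forall x : R, 0 < x < 1 -> 0 <= h x) ->
  (forall x : R, 0 < x < 1 -> {for x, continuous h}) ->
  (forall x : R, 0 < x < 1 -> is_derive x 1 H (h x)) ->
  (forall x : R, 0 < x < 1 -> `|H x| <= M) ->
  (\int[mu]_(x in `]0%R, 1%R[) (h x)%:E < +oo)%E.
Proof.
move=> h0 ch dH HM.
(* [n.+3] puts the left endpoint below 1/2, so that every interval is nondegenerate. *)
pose F n : set R := `[n.+3%:R^-1, 1 - n.+3%:R^-1]%classic.
have n3 n : 0 < n.+3%:R^-1 :> R by rewrite invr_gt0.
have F01 n x : F n x -> 0 < x < 1.
  rewrite /F /= in_itv /= => /andP[h1 h2].
  by rewrite (lt_le_trans (n3 n)) //= (le_lt_trans h2) // ltrBlDr ltrDl.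
have UF : `]0, 1[%classic = \bigcup_n F n.
  apply/seteqP; split => x /=; last by move=> [n _ /F01]; rewrite in_itv.
  rewrite in_itv /= => /andP[x0 x1].
  have m0 : 0 < Num.min x (1 - x) by rewrite lt_min x0 subr_gt0.
  have [k] := ltr_add_invr m0; rewrite add0r lt_min => /andP[k1 k2].
  have kk : k.+3%:R^-1 <= k.+1%:R^-1 :> R.
    by rewrite lef_pV2 ?posrE ?ltr0n // ler_nat -addn2 leq_addr.
  exists k => //; rewrite /F /= in_itv /= (le_trans kk (ltW k1)) /=.
  by rewrite lerBrDl -lerBrDr (le_trans kk) // ltW.
have mF n : measurable (F n) by exact: measurable_itv.
have mh n : measurable_fun (F n) (EFin \o h).
  apply/measurable_EFinP; apply: subspace_continuous_measurable_fun => //.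
  by apply: continuous_in_subspaceT => x /set_mem /F01; exact: ch.
have Fn n : (\int[mu]_(x in F n) (h x)%:E <= (M + M)%:E)%E.
  have lt3 : n.+3%:R^-1 < 1 - n.+3%:R^-1 :> R.
    rewrite ltrBrDl -mulr2n -[X in X < _]mulr_natl ltr_pdivrMr // mul1r ltr_nat.
    by [].
  have l01 : 0 < (n.+3%:R^-1 : R) < 1 by rewrite (F01 n) // /F /= in_itv /= lexx ltW.
  have r01 : 0 < (1 - n.+3%:R^-1 : R) < 1 by rewrite (F01 n) // /F /= in_itv /= lexx ltW.
  have cH x : 0 < x < 1 -> {for x, continuous H}.
    move=> x01; apply: differentiable_continuous; apply/derivable1_diffP.
    by have := dH x x01; case.
  rewrite (continuous_FTC2 (F := H)) //.
  - rewrite -EFinB lee_fin; apply: le_trans (ler_norm _) _.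
    by rewrite (le_trans (ler_normB _ _)) // lerD ?HM.
  - by apply: continuous_in_subspaceT => x /set_mem /F01; exact: ch.
  - split; [|exact: cvg_at_right_filter (cH _ l01)|exact: cvg_at_left_filter (cH _ r01)].
    move=> x /[!in_itv] /= /andP[h1 h2]; have x01 : 0 < x < 1.
      by apply: (F01 n); rewrite /F /= in_itv /= !ltW.
    by have := dH x x01; case.
  move=> x /[!in_itv] /= /andP[h1 h2]; have x01 : 0 < x < 1.
    by apply: (F01 n); rewrite /F /= in_itv /= !ltW.
  by rewrite derive1E; have := dH x x01; case.
apply: (@le_lt_trans _ _ (M + M)%:E); last exact: ltry.
rewrite UF; have cvgF : (\int[mu]_(x in F n) (h x)%:E)%E @[n --> \oo] -->
    (\int[mu]_(x in \bigcup_n F n) (h x)%:E)%E.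
  apply: ge0_nondecreasing_set_cvg_integral => //.
    move=> m n mn; apply/subsetPset => x; rewrite /F /= !in_itv /= => /andP[h1 h2].
    have nm : n.+3%:R^-1 <= m.+3%:R^-1 :> R by rewrite lef_pV2 ?posrE ?ltr0n // ler_nat.
    by rewrite (le_trans nm) // (le_trans h2) // lerB.
  by move=> n x /F01 x01; rewrite lee_fin h0.
rewrite -(cvg_lim _ cvgF) //; apply: lime_le; first by apply/cvg_ex; eexists; exact: cvgF.
by apply: nearW => n; exact: Fn.
Qed.

(** The maximum is at 1 or at 1/2 according to the sign of [be]; the sum covers both cases. *)
Lemma powR_half_le (be y : R) : 2^-1 <= y <= 1 -> y `^ be <= 1 + 2^-1 `^ be.
Proof.
move=> /andP[y0 y1]; have y_gt0 : 0 < y by rewrite (lt_le_trans _ y0) // invr_gt0.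
have [be0|be0] := leP 0 be.
  rewrite (@le_trans _ _ 1) // ?lerDl ?powR_ge0 //.
  by rewrite -[leRHS](powRr0 y) ger_powR // y_gt0.
rewrite (@le_trans _ _ (2^-1 `^ be)) // ?lerDr //.
rewrite -[be]opprK ![_ `^ (- - be)]powRN lef_pV2 ?posrE ?powR_gt0 ?invr_gt0 //.
by rewrite ge0_ler_powR ?nnegrE ?oppr_ge0 ?invr_ge0 // ltW.
Qed.

(** On each half of the interval one of the two factors is bounded, so the weight is at most
    [C * h], and [h] has an explicit bounded antiderivative. *)
Lemma integrable_beta_weight al be : -1 < al -> -1 < be ->
  mu.-integrable `]0, 1[ (EFin \o beta_weight al be).
Proof.
move=> al1 be1.
pose h x := x `^ al + (1 - x) `^ be.
pose C := 1 + 2^-1 `^ al + (1 + 2^-1 `^ be) : R.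
have al0 : 0 < al + 1 by rewrite -ltrBlDr sub0r.
have be0 : 0 < be + 1 by rewrite -ltrBlDr sub0r.
have mh : measurable_fun setT (h : RR -> R).
  apply: measurable_funD; first exact: measurable_powR.
  apply: (@measurableT_comp _ _ _ _ _ _ (fun x : RR => x `^ be)); first exact: measurable_powR.
  by apply: measurable_funB => //; exact: measurable_cst.
have h0 x : 0 <= h x by rewrite addr_ge0 // powR_ge0.
have dpow (c x : R) : 0 < x -> is_derive x 1 (fun y : R => y `^ (c + 1)) ((c + 1) * x `^ c).
  by move=> x0; have := is_derive1_powR (c + 1) x0; rewrite addrK.
have d1m (x : R) : is_derive x 1 (fun y : R => 1 - y) (-1).
  by rewrite -[X in is_derive _ _ _ X]sub0r; apply: is_deriveB.
have ih : mu.-integrable `]0, 1[ (EFin \o h).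
  apply/integrableP; split; first by apply/measurable_EFinP; exact: measurable_funTS.
  under eq_integral do rewrite /= ger0_norm //.
  apply: (@ge0_integral_antideriv_lty h
    (fun x => (al + 1)^-1 * x `^ (al + 1) - (be + 1)^-1 * (1 - x) `^ (be + 1))
    ((al + 1)^-1 + (be + 1)^-1)) => // x /andP[x0 x1].
  - have d1 := is_derive1_powR al x0.
    have y0 : 0 < 1 - x by rewrite subr_gt0.
    have d2 := is_derive1_comp (g := fun y : R => 1 - y) (is_derive1_powR be y0) (d1m x).
    have [dh _] := is_deriveD d1 d2.
    by apply: differentiable_continuous; apply/derivable1_diffP.
  - have y0 : 0 < 1 - x by rewrite subr_gt0.
    have d1 := is_deriveZ (al + 1)^-1 (dpow al x x0).
    have d2 := is_deriveZ (be + 1)^-1 (is_derive1_comp (g := fun y : R => 1 - y) (dpow be _ y0) (d1m x)).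
    have := is_deriveB d1 d2; congr is_derive.
    rewrite /GRing.scale /= !mulrA !mulVf ?gt_eqF // /h.
    by rewrite !mul1r mulrN1 opprK.
  - have le1 (c y : R) : 0 < c -> 0 < y < 1 -> 0 <= y `^ c <= 1.
      move=> c0 /andP[y0 y1]; rewrite powR_ge0 /= -[leRHS](powRr0 y).
      by rewrite ger_powR // ?y0 ltW.
    have y01 : 0 < 1 - x < 1 by apply/andP; split; lra.
    have x01 : 0 < x < 1 by rewrite x0.
    have /andP[p1 p2] := le1 _ _ al0 x01; have /andP[q1 q2] := le1 _ _ be0 y01.
    have ia : 0 <= (al + 1)^-1 by rewrite invr_ge0 ltW.
    have ib : 0 <= (be + 1)^-1 by rewrite invr_ge0 ltW.
    apply: le_trans (ler_normB _ _) _; apply: lerD.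
      by rewrite ger0_norm ?mulr_ge0 // ler_piMr.
    by rewrite ger0_norm ?mulr_ge0 // ler_piMr.
have iC : mu.-integrable `]0, 1[ (EFin \o (fun x => C * h x)).
  rewrite (_ : _ \o _ = (fun x => C%:E * (h x)%:E))%E; last first.
    by apply/funext => x /=; rewrite EFinM.
  exact: integrableZl.
apply: le_integrable iC => //.
  by apply/measurable_EFinP; apply: measurable_funTS; exact: measurable_beta_weight.
move=> x /=; rewrite in_itv /= => /andP[x0 x1]; rewrite lee_fin.
have C0 : 0 <= C by rewrite !addr_ge0 // powR_ge0.
rewrite ger0_norm ?beta_weight_ge0 // ger0_norm ?mulr_ge0 //.
have ph c : 0 <= 2^-1 `^ c :> R by exact: powR_ge0.
have px : 0 <= x `^ al by exact: powR_ge0.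
have py : 0 <= (1 - x) `^ be by exact: powR_ge0.
rewrite /beta_weight /h mulrDr; have [xh|xh] := leP x 2^-1.
  apply: (@le_trans _ _ (C * x `^ al)); last by rewrite lerDl mulr_ge0.
  rewrite mulrC ler_wpM2r //; apply: le_trans (powR_half_le be _) _.
    by apply/andP; split; lra.
  by rewrite /C lerDr addr_ge0.
apply: (@le_trans _ _ (C * (1 - x) `^ be)); last by rewrite lerDr mulr_ge0.
rewrite ler_wpM2r //; apply: le_trans (powR_half_le al _) _.
  by apply/andP; split; lra.
by rewrite /C lerDl addr_ge0.
Qed.

End BetaWeight.

(** * First-order expansions *)

Section Expansion.
Context {R : realType}.

(** Both bounds follow from 1 + z <= exp z: directly from below, and from above through exp z (1 -
    z) <= exp z exp (- z) = 1. *)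
Lemma expR_expansion (z : R) : `|z| <= 2^-1 -> `|expR z - 1 - z| <= 2 * z ^+ 2.
Proof.
rewrite ler_norml => /andP[z1 z2].
have h1 := expR_ge1Dx z; have h2 := expR_ge1Dx (- z).
have h3 : 0 < expR z by exact: expR_gt0.
have h4 : expR z * expR (- z) = 1 by rewrite -expRD subrr expR0.
rewrite ler_norml; apply/andP; split; first by have : 0 <= z ^+ 2 by [exact: sqr_ge0]; nra.
have h5 : expR z * (1 - z) <= 1 by rewrite -[leRHS]h4 ler_pM2l.
have h6 : 1 <= (1 + z + 2 * z ^+ 2) * (1 - z).
  have -> : (1 + z + 2 * z ^+ 2) * (1 - z) = 1 + z ^+ 2 * (1 - 2 * z) by ring.
  by rewrite lerDl mulr_ge0 ?sqr_ge0 // subr_ge0; lra.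
have h7 : 0 < 1 - z by lra.
have : expR z <= 1 + z + 2 * z ^+ 2 by rewrite -(ler_pM2r h7) (le_trans h5 h6).
lra.
Qed.

(** The lower bound is the inequality ln (1 + z) <= z applied to the inverse of [1 + y]. *)
Lemma ln_expansion (y : R) : `|y| <= 2^-1 -> `|ln (1 + y) - y| <= 2 * y ^+ 2.
Proof.
rewrite ler_norml => /andP[y1 y2].
have h0 : 0 < 1 + y by lra.
have up (z : R) : -1 < z -> ln (1 + z) <= z by move=> hz; apply: le_ln1Dx.
have h1 : ln (1 + y) <= y by apply: up; lra.
have h2 : - ln (1 + y) <= - (y / (1 + y)).
  have e : (1 + y)^-1 = 1 + - (y / (1 + y)) by field; rewrite gt_eqF.
  rewrite -lnV ?posrE // {1}e; apply: up.
  rewrite ltrNr opprK ltr_pdivrMr //; lra.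
have h3 : y / (1 + y) = y - y ^+ 2 / (1 + y) by field; rewrite gt_eqF.
have h4 : y ^+ 2 / (1 + y) <= 2 * y ^+ 2.
  rewrite ler_pdivrMr //; have := sqr_ge0 y; nra.
rewrite ler_norml; apply/andP; split; lra.
Qed.

(** With l = ln (1 + y) the power is exp (c l). The error of the exponential gives [8 * c ^+ 2],
    because |l| <= 2 |y|, and that of the logarithm gives 2 |c|. *)
Lemma powR_expansion (c y : R) : `|y| <= 2^-1 -> `|c| * `|y| <= 4^-1 ->
  `|(1 + y) `^ c - 1 - c * y| <= (8 * c ^+ 2 + 2 * `|c|) * y ^+ 2.
Proof.
move=> hy hcy; have h0 : 0 < 1 + y by move: hy; rewrite ler_norml; lra.
have hl := ln_expansion hy; set l := ln (1 + y) in hl.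
have -> : (1 + y) `^ c = expR (c * l) by rewrite /powR gt_eqF.
have y2 : y ^+ 2 = `|y| ^+ 2 by rewrite real_normK // num_real.
have hl2 : `|l| <= 2 * `|y|.
  have -> : l = (l - y) + y by rewrite subrK.
  rewrite (le_trans (ler_normD _ _)) //.
  have : 2 * y ^+ 2 <= `|y| by rewrite y2; have := normr_ge0 y; nra.
  lra.
have hz : `|c * l| <= 2 * (`|c| * `|y|).
  by rewrite normrM mulrCA ler_wpM2l.
have hz2 : `|c * l| <= 2^-1 by lra.
have -> : expR (c * l) - 1 - c * y = (expR (c * l) - 1 - c * l) + c * (l - y) by ring.
rewrite (le_trans (ler_normD _ _)) // mulrDl lerD //.
  rewrite (le_trans (expR_expansion hz2)) //.
  have -> : 8 * c ^+ 2 * y ^+ 2 = 2 * (2 * (`|c| * `|y|)) ^+ 2.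
    rewrite y2 -[c ^+ 2]real_normK ?num_real //; ring.
  rewrite ler_pM2l // -[(c * l) ^+ 2]real_normK ?num_real //.
  by rewrite lerXn2r ?nnegrE // mulr_ge0 // mulr_ge0.
have -> : 2 * `|c| * y ^+ 2 = `|c| * (2 * y ^+ 2) by ring.
by rewrite normrM ler_wpM2l.
Qed.

Variable N : nat.
Implicit Types (h : R -> N.-tuple R -> R) (f : N.-tuple R -> R).

(* h e = f + e f1 + O(e ^ 2) for small e >= 0, uniformly on the cube. *)
Definition expansion h f f1 : Prop := exists C e0 : R, [/\ 0 <= C, 0 < e0, e0 <= 1 &
  forall e t, 0 <= e <= e0 -> in_cube t ->
    [/\ `|f t| <= C, `|f1 t| <= C & `|h e t - f t - e * f1 t| <= C * e ^+ 2]].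

Lemma eq_expansion h h' f f' f1 f1' : 
  (exists2 e0, 0 < e0 & forall e t, 0 <= e <= e0 -> in_cube t -> h e t = h' e t) ->
  (forall t, in_cube t -> f t = f' t) -> (forall t, in_cube t -> f1 t = f1' t) ->
  expansion h f f1 -> expansion h' f' f1'.
Proof.
move=> [e1 e1_gt0 hh'] ff' ff1' [C [e0 [C0 e0_gt0 e0_le1 H]]].
exists C, (Num.min e0 e1); split=> //.
- by rewrite lt_min e0_gt0.
- by rewrite ge_min e0_le1.
move=> e t /andP[e_ge0]; rewrite le_min => /andP[le_e0 le_e1] ht.
rewrite -hh' ?e_ge0 // -ff' // -ff1' //; apply: H => //.
by rewrite e_ge0.
Qed.

Lemma expansion_const f C : (forall t, in_cube t -> `|f t| <= C) ->
  expansion (fun _ => f) f (fun _ => 0).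
Proof.
move=> fC; exists `|C|, 1; split=> // e t _ ht; split.
- by rewrite (le_trans (fC t ht)) // ler_norm.
- by rewrite normr0.
- by rewrite subrr mulr0 subrr normr0 mulr_ge0 // sqr_ge0.
Qed.

Lemma expansionD h h' f f' f1 f1' : expansion h f f1 -> expansion h' f' f1' ->
  expansion (fun e t => h e t + h' e t) (fun t => f t + f' t) (fun t => f1 t + f1' t).
Proof.
move=> [C [e0 [C0 e0_gt0 e0_le1 H]]] [C' [e0' [C'0 e0'_gt0 e0'_le1 H']]].
exists (C + C'), (Num.min e0 e0'); split.
- exact: addr_ge0.
- by rewrite lt_min e0_gt0.
- by rewrite ge_min e0_le1.
move=> e t /andP[e_ge0]; rewrite le_min => /andP[le_e0 le_e0'] ht.
have [||h1 h2 h3] := H e t; rewrite ?e_ge0 //.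
have [||h1' h2' h3'] := H' e t; rewrite ?e_ge0 //.
split; [by rewrite (le_trans (ler_normD _ _)) ?lerD..|].
have -> : h e t + h' e t - (f t + f' t) - e * (f1 t + f1' t) =
  (h e t - f t - e * f1 t) + (h' e t - f' t - e * f1' t) by ring.
by rewrite mulrDl (le_trans (ler_normD _ _)) ?lerD.
Qed.

Lemma expansionM h h' f f' f1 f1' : expansion h f f1 -> expansion h' f' f1' ->
  expansion (fun e t => h e t * h' e t) (fun t => f t * f' t)
    (fun t => f1 t * f' t + f t * f1' t).
Proof.
move=> [C [e0 [C0 e0_gt0 e0_le1 H]]] [C' [e0' [C'0 e0'_gt0 e0'_le1 H']]].
have CC' : 0 <= C * C' by exact: mulr_ge0.
(* The remainder below splits into six terms, each at most [C * C' * e ^+ 2]. *)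
exists (7 * (C * C')), (Num.min e0 e0'); split.
- exact: mulr_ge0.
- by rewrite lt_min e0_gt0.
- by rewrite ge_min e0_le1.
move=> e t /andP[e_ge0]; rewrite le_min => /andP[le_e0 le_e0'] ht.
have [||h1 h2 h3] := H e t; rewrite ?e_ge0 //.
have [||h1' h2' h3'] := H' e t; rewrite ?e_ge0 //.
have le_e1 : e <= 1 by exact: le_trans le_e0 _.
have b1 : `|f t * f' t| <= C * C' by rewrite normrM ler_pM.
have b2 : `|f1 t * f' t| <= C * C' by rewrite normrM ler_pM.
have b3 : `|f t * f1' t| <= C * C' by rewrite normrM ler_pM.
have b4 : `|f1 t * f1' t| <= C * C' by rewrite normrM ler_pM.
split.
- by apply: le_trans b1 _; lra.
- by rewrite (le_trans (ler_normD _ _)) //; lra.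
set r := h e t - f t - e * f1 t in h3; set r' := h' e t - f' t - e * f1' t in h3'.
have e2 : 0 <= e ^+ 2 by exact: sqr_ge0.
have e2_le : e ^+ 2 <= 1 by rewrite expr_le1.
have -> : h e t * h' e t - f t * f' t - e * (f1 t * f' t + f t * f1' t) =
  e ^+ 2 * (f1 t * f1' t) + r * f' t + f t * r' + e * (r * f1' t) + e * (f1 t * r') + r * r'.
  by rewrite /r /r'; ring.
have c1 : `|e ^+ 2 * (f1 t * f1' t)| <= C * C' * e ^+ 2.
  by rewrite normrM ger0_norm // mulrC ler_wpM2r.
have c2 : `|r * f' t| <= C * C' * e ^+ 2 by rewrite normrM mulrAC ler_pM.
have c3 : `|f t * r'| <= C * C' * e ^+ 2 by rewrite normrM -mulrA ler_pM.
have c4 : `|e * (r * f1' t)| <= C * C' * e ^+ 2.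
  have d : `|r * f1' t| <= C * C' * e ^+ 2 by rewrite normrM mulrAC ler_pM.
  by rewrite normrM ger0_norm // (le_trans _ d) // ler_piMl.
have c5 : `|e * (f1 t * r')| <= C * C' * e ^+ 2.
  have d : `|f1 t * r'| <= C * C' * e ^+ 2 by rewrite normrM -mulrA ler_pM.
  by rewrite normrM ger0_norm // (le_trans _ d) // ler_piMl.
have c6 : `|r * r'| <= C * C' * e ^+ 2.
  have d : `|r * r'| <= (C * e ^+ 2) * (C' * e ^+ 2) by rewrite normrM ler_pM.
  apply: le_trans d _; rewrite mulrACA ler_wpM2l // ler_piMl //.
apply: le_trans (_ : C * C' * e ^+ 2 + C * C' * e ^+ 2 + C * C' * e ^+ 2 +
  C * C' * e ^+ 2 + C * C' * e ^+ 2 + C * C' * e ^+ 2 <= _); last first.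
  have : 0 <= C * C' * e ^+ 2 by exact: mulr_ge0.
  lra.
do 5 (rewrite (le_trans (ler_normD _ _)) // lerD //).
Qed.

Lemma expansion_prod1 (I : Type) (r : seq I) (P : pred I) (h : I -> R -> N.-tuple R -> R)
    (f1 : I -> N.-tuple R -> R) :
  (forall i, P i -> expansion (h i) (fun=> 1) (f1 i)) ->
  expansion (fun e t => \prod_(i <- r | P i) h i e t) (fun=> 1)
    (fun t => \sum_(i <- r | P i) f1 i t).
Proof.
move=> H; elim: r => [|i r IH].
  apply: eq_expansion (expansion_const (C := 1) (f := fun=> 1) _) => //.
  - by exists 1 => // e t _ _; rewrite big_nil.
  - by move=> t _; rewrite big_nil.
  - by move=> t _; rewrite normr1.
have [Pi|nPi] := boolP (P i); last first.
  apply: eq_expansion IH => //; first by exists 1 => // e t _ _; rewrite big_cons (negbTE nPi).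
  by move=> t _; rewrite big_cons (negbTE nPi).
apply: eq_expansion (expansionM (H i Pi) IH) => //.
- by exists 1 => // e t _ _; rewrite big_cons Pi.
- by move=> t _; rewrite mulr1.
- by move=> t _; rewrite big_cons Pi mulr1 mul1r.
Qed.

Lemma expansion_sum (I : Type) (r : seq I) (h : I -> R -> N.-tuple R -> R)
    (f f1 : I -> N.-tuple R -> R) :
  (forall i, expansion (h i) (f i) (f1 i)) ->
  expansion (fun e t => \sum_(i <- r) h i e t) (fun t => \sum_(i <- r) f i t)
    (fun t => \sum_(i <- r) f1 i t).
Proof.
move=> H; elim: r => [|i r IH].
  apply: eq_expansion (expansion_const (C := 0) (f := fun=> 0) _) => //.
  - by exists 1 => // e t _ _; rewrite big_nil.
  - by move=> t _; rewrite big_nil.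
  - by move=> t _; rewrite big_nil.
  - by move=> t _; rewrite normr0.
apply: eq_expansion (expansionD (H i) IH) => //.
- by exists 1 => // e t _ _; rewrite big_cons.
- by move=> t _; rewrite big_cons.
- by move=> t _; rewrite big_cons.
Qed.

Lemma expansion_affine f f1 C : (forall t, in_cube t -> `|f t| <= C) ->
  (forall t, in_cube t -> `|f1 t| <= C) ->
  expansion (fun e t => f t + e * f1 t) f f1.
Proof.
move=> fC f1C; exists `|C|, 1; split=> // e t _ ht; split.
- by rewrite (le_trans (fC t ht)) // ler_norm.
- by rewrite (le_trans (f1C t ht)) // ler_norm.
- by rewrite addrAC addrK subrr normr0 mulr_ge0 // sqr_ge0.
Qed.

Lemma expansion_exp h f f1 m : expansion h f f1 ->
  expansion (fun e t => h e t ^+ m) (fun t => f t ^+ m)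
    (fun t => m%:R * (f t ^+ m.-1 * f1 t)).
Proof.
move=> H; elim: m => [|m IH].
  apply: eq_expansion (expansion_const (C := 1) (f := fun=> 1) _) => //.
  - by exists 1.
  - by move=> t _; rewrite mul0r.
  - by move=> t _; rewrite normr1.
apply: eq_expansion (expansionM H IH) => //.
- by exists 1 => // e t _ _; rewrite exprS.
- by move=> t _; rewrite exprS.
- move=> t _ /=; case: m {IH} => [|m]; first by rewrite !expr0; ring.
  by rewrite /= exprS -[m.+2%:R]natr1; ring.
Qed.

Lemma expansion_powR f1 (c B : R) : (forall t, in_cube t -> `|f1 t| <= B) ->
  expansion (fun e t => (1 + e * f1 t) `^ c) (fun=> 1) (fun t => c * f1 t).
Proof.
(* For [e <= D^-1] both e |B| and |c| e |B| are at most 1/4, which is enough for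
   [powR_expansion]. *)
move=> f1B; pose D := 4 * (1 + `|c|) * (1 + `|B|).
have D4 : 4 <= D.
  rewrite /D -mulrA ler_peMr //; have := normr_ge0 c; have := normr_ge0 B; nra.
have D_gt0 : 0 < D by lra.
have c0 := normr_ge0 c; have B0 := normr_ge0 B.
have q0 : 0 <= (8 * c ^+ 2 + 2 * `|c|) by have := sqr_ge0 c; lra.
have q1 : 0 <= (8 * c ^+ 2 + 2 * `|c|) * B ^+ 2 by rewrite mulr_ge0 // sqr_ge0.
have cB0 : 0 <= `|c| * `|B| by exact: mulr_ge0.
exists (1 + `|c| * `|B| + (8 * c ^+ 2 + 2 * `|c|) * B ^+ 2), D^-1; split.
- lra.
- by rewrite invr_gt0.
- by rewrite invf_le1 //; lra.
move=> e t /andP[e0 eD] ht; have fB := f1B t ht.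
have fB' : `|f1 t| <= `|B| by rewrite (le_trans fB) // ler_norm.
have eB : e * `|B| * (4 * (1 + `|c|)) <= 1.
  apply: le_trans (_ : e * D <= _).
    have -> : e * D = e * (1 + `|B|) * (4 * (1 + `|c|)) by rewrite /D; ring.
    by rewrite ler_wpM2r ?ler_wpM2l //; lra.
  by rewrite -ler_pdivlMr // div1r.
have ef : `|e * f1 t| <= e * `|B| by rewrite normrM ger0_norm // ler_wpM2l.
have eB0 : 0 <= e * `|B| by exact: mulr_ge0.
split.
- rewrite normr1; lra.
- rewrite normrM; apply: le_trans (_ : `|c| * `|B| <= _); first exact: ler_wpM2l.
  by lra.
apply: le_trans (_ : (8 * c ^+ 2 + 2 * `|c|) * (e * f1 t) ^+ 2 <= _).
  rewrite mulrCA; apply: powR_expansion; first by apply: le_trans ef _; nra.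
  apply: le_trans (_ : `|c| * (e * `|B|) <= _); first exact: ler_wpM2l.
  nra.
rewrite exprMn mulrCA mulrC ler_wpM2r ?sqr_ge0 //.
apply: le_trans (_ : (8 * c ^+ 2 + 2 * `|c|) * B ^+ 2 <= _).
  rewrite ler_wpM2l // -[f1 t ^+ 2]real_normK ?num_real // -[B ^+ 2]real_normK ?num_real //.
  by rewrite lerXn2r ?nnegrE.
lra.
Qed.

End Expansion.

(** * The loop equations of the Jacobi ensemble *)

Section PowerSums.
Context {R : realType}.
Notation RR := (measurableTypeR R).
Local Open Scope classical_set_scope.
Local Open Scope ring_scope.
Variable N : nat.
Implicit Types (t : N.-tuple R) (s : seq nat).

Lemma in_cube_tnth t i : in_cube t -> 0 < tnth t i < 1.
Proof. by move/all_tnthP; apply. Qed.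

Definition power_prod s t : R := \prod_(i <- s) power_sum i t.

Lemma power_prod_cons m s t : power_prod (m :: s) t = power_sum m t * power_prod s t.
Proof. by rewrite /power_prod big_cons. Qed.

Lemma measurable_power_sum m :
  measurable_fun setT (power_sum m : N.-tuple RR -> R).
Proof.
apply: measurable_sum => i; apply: measurable_funX; exact: measurable_tnth.
Qed.

Lemma measurable_power_prod s : measurable_fun setT (power_prod s : N.-tuple RR -> R).
Proof. by apply: measurable_prod => i _; exact: measurable_power_sum. Qed.

Lemma power_sum_bound m t : in_cube t -> 0 <= power_sum m t <= N%:R.
Proof.
move=> ht; rewrite sumr_ge0 => [|i _] /=.
  rewrite -[N in leRHS]card_ord -sum1_card natr_sum; apply: ler_sum => i _.
  by have /andP[/ltW x0 /ltW x1] := in_cube_tnth i ht; rewrite exprn_ile1.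
by have /andP[/ltW x0 _] := in_cube_tnth i ht; rewrite exprn_ge0.
Qed.

Lemma power_prod_bound s t : in_cube t -> 0 <= power_prod s t <= N%:R ^+ size s.
Proof.
move=> ht; elim: s => [|m s IH]; first by rewrite /power_prod big_nil ler01 lexx.
have /andP[p0 p1] := power_sum_bound m ht; move: IH => /andP[q0 q1].
by rewrite power_prod_cons mulr_ge0 //= exprS ler_pM.
Qed.

End PowerSums.

Section JacobiWeight.
Context {R : realType}.
Notation RR := (measurableTypeR R).
Notation mu := (@lebesgue_measure R).
Local Open Scope classical_set_scope.
Local Open Scope ring_scope.
Variables (N : nat) (kappa a b : R).
Hypothesis adm : jacobi_admissible N kappa a b.

Notation u := (beta_weight (kappa * a) (kappa * b)).
Notation w := (@jacobi_weight R N kappa a b).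

Let kappa_gt0 : 0 < kappa. Proof. by case: adm. Qed.

Lemma jacobi_beta_integrable : mu.-integrable `]0, 1[ (EFin \o u).
Proof. by case: adm => *; exact: integrable_beta_weight. Qed.

Lemma jacobi_weight_ge0 t : 0 <= w t.
Proof.
rewrite mulr_ge0 ?prodr_ge0 // => i _; first by rewrite mulr_ge0 ?powR_ge0.
by apply: prodr_ge0 => j _; exact: powR_ge0.
Qed.

Lemma measurable_jacobi_weight : measurable_fun setT (w : N.-tuple RR -> R).
Proof.
apply: measurable_funM.
  apply: measurable_prod => i _.
  apply: (@measurableT_comp _ _ _ _ _ _ (u : RR -> R)); first exact: measurable_beta_weight.
  exact: measurable_tnth.
apply: measurable_prod => i _; under eq_fun do rewrite big_mkcond.
apply: measurable_prod => j _; have [_|_] := boolP (i < j)%N; last exact: measurable_cst.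
apply: (@measurableT_comp _ _ _ _ _ _ (fun x : RR => x `^ (2 * kappa))).
  exact: measurable_powR.
by apply: measurableT_comp => //; apply: measurable_funB; exact: measurable_tnth.
Qed.

(** As [kappa] is positive, the factors in the differences of variables are at most 1 on the
    cube. *)
Lemma jacobi_weight_le t : in_cube t -> w t <= \prod_(x <- t) u x.
Proof.
move=> ht; rewrite big_tuple /jacobi_weight ler_piMr //.
  by apply: prodr_ge0 => i _; exact: beta_weight_ge0.
apply: prodr_ile1 => i _; rewrite prodr_ge0 /= => [|j _]; last exact: powR_ge0.
apply: prodr_ile1 => j _; rewrite powR_ge0 /=.
have /andP[x0 x1] := in_cube_tnth i ht; have /andP[y0 y1] := in_cube_tnth j ht.
apply: le_trans (_ : 1 `^ (2 * kappa) <= _); last by rewrite powR1.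
rewrite ge0_ler_powR ?nnegrE ?mulr_ge0 ?(ltW kappa_gt0) //.
by rewrite ler_norml; apply/andP; split; lra.
Qed.

Lemma cube_dom_weight : cube_dom u w.
Proof.
split; first exact: measurable_jacobi_weight.
exists 1 => // t ht; rewrite mul1r ger0_norm ?jacobi_weight_ge0 //.
exact: jacobi_weight_le.
Qed.

Lemma cube_dom_power_prod s : cube_dom u (fun t => power_prod s t * w t).
Proof.
apply: (cube_domM (B := N%:R ^+ size s)) => //.
- exact: cube_dom_weight.
- exact: measurable_power_prod.
- by move=> t /(power_prod_bound s) /andP[p0 p1]; rewrite ger0_norm.
Qed.

Lemma jacobi_weight_integral_gt0 : 0 < cube_integral w.
Proof.
have N0 : (0 < N)%N by case: adm.
have N0' : 0 < N%:R :> R by rewrite ltr0n.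
(* On the product of the intervals ]i/N, (i+1)/N[ the variables are strictly increasing, so no
   difference vanishes. *)
apply: (cube_integral_gt0 (@beta_weight_ge0 _ _ _) jacobi_beta_integrable
  (a := fun i => i%:R / N%:R) (b := fun i => i.+1%:R / N%:R)).
- exact: cube_dom_weight.
- by move=> t _; exact: jacobi_weight_ge0.
- move=> i iN; split; first by rewrite divr_ge0.
    by rewrite ltr_pM2r ?invr_gt0 // ltr_nat.
  by rewrite ler_pdivrMr // mul1r ler_nat.
move=> t ht.
have t01 i : 0 < tnth t i < 1.
  have /andP[h1 h2] := ht i; rewrite (le_lt_trans _ h1) ?divr_ge0 //=.
  by rewrite (lt_le_trans h2) // ler_pdivrMr // mul1r ler_nat ltn_ord.
have t_incr (i j : 'I_N) : (i < j)%N -> tnth t i < tnth t j.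
  move=> ij; have /andP[_ h1] := ht i; have /andP[h2 _] := ht j.
  by rewrite (lt_trans h1) // (le_lt_trans _ h2) // ler_pM2r ?invr_gt0 // ler_nat.
apply: mulr_gt0.
  apply: prodr_gt0 => i _; have /andP[x0 x1] := t01 i.
  by rewrite mulr_gt0 // powR_gt0 // subr_gt0.
apply: prodr_gt0 => i _; apply: prodr_gt0 => j ij.
by rewrite powR_gt0 // normr_gt0 subr_eq0 gt_eqF // t_incr.
Qed.

End JacobiWeight.

(** * The substitution along the vector field x^(k+1) (1 - x) *)

Section LoopVectorField.
Context {R : realType}.
Variables (k : nat) (e : R).
Hypothesis e_ge0 : 0 <= e.
Hypothesis e_small : e * k.+2%:R <= 2^-1.

Definition flow_poly : {poly R} := 'X + e *: ('X^(k.+1) - 'X^(k.+2)).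

(** With v(x) = x^(k+1) (1 - x), the functions [flow_left], [flow_right], [flow_deriv] and
    [flow_pair] are v / x, - v / (1 - x), v' and the divided difference of v; [hsum m] is the
    divided difference of x^(m+1). *)
Definition flow_left (x : R) := x ^+ k * (1 - x).
Definition flow_right (x : R) := - x ^+ k.+1.
Definition flow_deriv (x : R) := k.+1%:R * x ^+ k - k.+2%:R * x ^+ k.+1.
Definition hsum m (x y : R) := \sum_(i < m.+1) x ^+ (m - i) * y ^+ i.
Definition flow_pair (x y : R) := hsum k x y - hsum k.+1 x y.

Lemma horner_flow_poly x : flow_poly.[x] = x + e * (x ^+ k.+1 - x ^+ k.+2).
Proof. by rewrite /flow_poly !hornerE. Qed.

Lemma flow_polyE x : flow_poly.[x] = x * (1 + e * flow_left x).
Proof. by rewrite horner_flow_poly /flow_left !exprS; ring. Qed.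

Lemma flow_polyC x : 1 - flow_poly.[x] = (1 - x) * (1 + e * flow_right x).
Proof. by rewrite horner_flow_poly /flow_right !exprS; ring. Qed.

Lemma flow_polyB x y : flow_poly.[x] - flow_poly.[y] = (x - y) * (1 + e * flow_pair x y).
Proof.
have E m : x ^+ m.+1 - y ^+ m.+1 = (x - y) * hsum m x y.
  by rewrite subrXX.
have -> : (x - y) * (1 + e * flow_pair x y) =
  (x - y) + e * ((x - y) * hsum k x y - (x - y) * hsum k.+1 x y) by rewrite /flow_pair; ring.
rewrite -!E !horner_flow_poly; ring.
Qed.

Lemma flow_poly_deriv x : flow_poly^`().[x] = 1 + e * flow_deriv x.
Proof.
have d m : ('X^(m.+1))^`() = m.+1%:R *: 'X^m :> {poly R}.
  by rewrite derivXn scaler_nat.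
by rewrite /flow_poly derivD derivX derivZ derivB !d !hornerE.
Qed.

Section Bounds.
Variables (x y : R).
Hypothesis x01 : 0 <= x <= 1.
Hypothesis y01 : 0 <= y <= 1.

Let xk m : 0 <= x ^+ m <= 1.
Proof. by case/andP: x01 => h1 h2; rewrite exprn_ge0 // exprn_ile1. Qed.

Lemma flow_left_bound : `|flow_left x| <= k.+2%:R.
Proof.
case/andP: x01 => h1 h2; have /andP[h3 h4] := xk k.
rewrite /flow_left ger0_norm ?mulr_ge0 ?subr_ge0 //.
apply: le_trans (_ : 1 <= _); last by rewrite ler1n.
by rewrite mulr_ile1 // ?subr_ge0 ?gerBl.
Qed.

Lemma flow_right_bound : `|flow_right x| <= k.+2%:R.
Proof.
have /andP[h3 h4] := xk k.+1; rewrite normrN ger0_norm //.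
by rewrite (le_trans h4) // ler1n.
Qed.

Lemma flow_deriv_bound : `|flow_deriv x| <= k.+2%:R.
Proof.
have /andP[h1 h2] := xk k; have /andP[h3 h4] := xk k.+1.
have i1 : 0 <= k.+1%:R * x ^+ k <= k.+2%:R.
  rewrite mulr_ge0 //=; apply: le_trans (_ : k.+1%:R <= _); last by rewrite ler_nat.
  by rewrite ler_piMr.
have i2 : 0 <= k.+2%:R * x ^+ k.+1 <= k.+2%:R by rewrite mulr_ge0 //= ler_piMr.
rewrite ler_norml; move: i1 i2 => /andP[? ?] /andP[? ?]; apply/andP; split; rewrite /flow_deriv; lra.
Qed.

Lemma hsum_bound m : 0 <= hsum m x y <= m.+1%:R.
Proof.
case/andP: x01 => x0 x1; case/andP: y01 => y0 y1.
rewrite sumr_ge0 /= => [|i _]; last by rewrite mulr_ge0 // exprn_ge0.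
rewrite -[m.+1 in leRHS]card_ord -sum1_card natr_sum; apply: ler_sum => i _.
by rewrite mulr_ile1 ?exprn_ge0 ?exprn_ile1.
Qed.

Lemma flow_pair_bound : `|flow_pair x y| <= k.+2%:R.
Proof.
have /andP[h1 h2] := hsum_bound k; have /andP[h3 h4] := hsum_bound k.+1.
have : k.+1%:R <= k.+2%:R :> R by rewrite ler_nat.
by rewrite ler_norml => h5; apply/andP; split; rewrite /flow_pair; lra.
Qed.

(** All four functions are bounded by [k.+2%:R] on [0, 1], so [e_small] keeps every factor of the
    substitution away from 0. *)
Lemma flow_small (z : R) : `|z| <= k.+2%:R -> 2^-1 <= 1 + e * z <= 2.
Proof.
move=> hz; have : `|e * z| <= 2^-1.
  by rewrite normrM ger0_norm // (le_trans _ e_small) // ler_wpM2l.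
by rewrite ler_norml => /andP[h1 h2]; apply/andP; split; lra.
Qed.

End Bounds.

End LoopVectorField.

Section FlowSubstitution.
Context {R : realType}.
Notation RR := (measurableTypeR R).
Notation mu := (@lebesgue_measure R).
Local Open Scope classical_set_scope.
Local Open Scope ring_scope.
Variables (N : nat) (kappa a b : R).
Hypothesis adm : jacobi_admissible N kappa a b.
Notation u := (beta_weight (kappa * a) (kappa * b)).
Notation w := (@jacobi_weight R N kappa a b).

Lemma powR_le_two (c z : R) : 2^-1 <= z <= 2 -> z `^ c <= 2 `^ `|c|.
Proof.
move=> /andP[z1 z2]; have z0 : 0 < z by rewrite (lt_le_trans _ z1) // invr_gt0.
have [c0|c0] := leP 0 c; first by rewrite ger0_norm // ge0_ler_powR ?nnegrE // ltW.
rewrite ltr0_norm //.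
have -> : z `^ c = z^-1 `^ (- c).
  by rewrite -powR_inv1 ?(ltW z0) // -powRrM mulN1r opprK.
rewrite ge0_ler_powR ?nnegrE ?invr_ge0 ?oppr_ge0 ?(ltW c0) ?(ltW z0) //.
by rewrite -[leRHS]invrK lef_pV2 ?posrE ?invr_gt0.
Qed.

Variable k : nat.

(** Ratio of the transported weight, Jacobian included, to the weight. *)
Definition flow_density (e : R) (t : N.-tuple R) : R :=
  (\prod_(l < N) ((1 + e * flow_left k (tnth t l)) `^ (kappa * a) *
                  (1 + e * flow_right k (tnth t l)) `^ (kappa * b) *
                  (1 + e * flow_deriv k (tnth t l)))) *
  \prod_(j < N) \prod_(l < N | (j < l)%N)
    (1 + e * flow_pair k (tnth t l) (tnth t j)) `^ (2 * kappa).

Section SmallStep.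
Variable e : R.
Hypothesis e_ge0 : 0 <= e.
Hypothesis e_small : e * k.+2%:R <= 2^-1.
Notation p := (flow_poly k e).

Let small := flow_small e_ge0 e_small.

Lemma flow_poly_01 x : 0 < x < 1 -> 0 < p.[x] < 1.
Proof.
move=> x01; have x01' : 0 <= x <= 1 by case/andP: x01 => /ltW -> /ltW ->.
have /andP[h1 _] := small (flow_left_bound k x01').
have /andP[h2 _] := small (flow_right_bound k x01').
case/andP: x01 => x0 x1; rewrite -[X in _ && X]subr_gt0 flow_polyC flow_polyE.
by apply/andP; split; apply: mulr_gt0; lra.
Qed.

(* The substitution maps each factor of the weight to itself times a smooth
   factor close to 1, including the factors |x_l - x_j|: no singularity of the
   derivative of the weight at x_l = x_j has to be integrated. *)
Lemma jacobi_weight_flow t : in_cube t ->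
  w (map_tuple (horner p) t) * \prod_(x <- t) p^`().[x] = flow_density e t * w t.
Proof.
move=> ht; have t01 i : 0 <= tnth t i <= 1.
  by have /andP[/ltW -> /ltW ->] := in_cube_tnth i ht.
rewrite /jacobi_weight /flow_density big_tuple.
rewrite mulrAC [RHS]mulrACA; congr (_ * _).
  rewrite -!big_split /=; apply: eq_bigr => i _; rewrite !tnth_map flow_poly_deriv flow_polyC flow_polyE.
  have /andP[h1 _] := small (flow_left_bound k (t01 i)).
  have /andP[h2 _] := small (flow_right_bound k (t01 i)).
  have /andP[x0 x1] := t01 i.
  rewrite !powRM ?subr_ge0 //; [|lra..]; ring.
rewrite -big_split /=; apply: eq_bigr => i _; rewrite -big_split /=; apply: eq_bigr => j _.
have /andP[h1 _] := small (flow_pair_bound k (t01 j) (t01 i)).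
rewrite !tnth_map flow_polyB normrM powRM // mulrC; congr (_ `^ _ * _).
by rewrite ger0_norm //; lra.
Qed.

Lemma cube_integral_flow (f : N.-tuple R -> R) : cube_dom u f ->
  cube_integral f = cube_integral
    (fun t => f (map_tuple (horner p) t) * \prod_(x <- t) p^`().[x]) /\
  cube_dom u (fun t => f (map_tuple (horner p) t) * \prod_(x <- t) p^`().[x]).
Proof.
move=> df.
have m1 : measurable_fun setT (horner p : RR -> R) by exact: measurable_horner.
have m2 : measurable_fun setT (horner p^`() : RR -> R) by exact: measurable_horner.
have gG (x : R) : 0 < x < 1 -> 0 <= p^`().[x] <= 2.
  move=> /andP[/ltW x0 /ltW x1]; have x01 : 0 <= x <= 1 by rewrite x0.
  rewrite flow_poly_deriv; have /andP[h1 h2] := small (flow_deriv_bound k x01).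
  by apply/andP; split; lra.
(* Both correcting factors lie between 1/2 and 2, which bounds their powers whatever the sign of the
   exponents. *)
have uK (x : R) : 0 < x < 1 -> u p.[x] <= (2 `^ `|kappa * a| * 2 `^ `|kappa * b|) * u x.
  move=> /andP[/ltW x0 /ltW x1]; have x01 : 0 <= x <= 1 by rewrite x0.
  have h1 := small (flow_left_bound k x01); have h2 := small (flow_right_bound k x01).
  rewrite /beta_weight flow_polyC flow_polyE.
  have l1 : 0 <= 1 + e * flow_left k x by case/andP: h1 => *; lra.
  have l2 : 0 <= 1 + e * flow_right k x by case/andP: h2 => *; lra.
  rewrite !powRM ?subr_ge0 //.
  set A := x `^ _; set B := (1 - x) `^ _.
  have A0 : 0 <= A by exact: powR_ge0.
  have B0 : 0 <= B by exact: powR_ge0.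
  rewrite mulrACA [leRHS]mulrC ler_wpM2l ?mulr_ge0 // ler_pM ?powR_ge0 ?powR_le_two //.
have sub (f0 : RR -> R) : measurable_fun setT f0 ->
    \int[mu]_(x in `]0, 1[) f0 x = \int[mu]_(x in `]0, 1[) (f0 p.[x] * p^`().[x]).
  apply: Rintegral_poly_subst.
  - by rewrite horner_flow_poly !expr0n; ring.
  - by rewrite horner_flow_poly !expr1n; ring.
  - move=> x y x0 xy y1; rewrite -subr_gt0 flow_polyB.
    have x01 : 0 <= x <= 1 by rewrite x0 (le_trans (ltW xy)).
    have y01 : 0 <= y <= 1 by rewrite y1 (le_trans x0 (ltW xy)).
    have /andP[h1 _] := small (flow_pair_bound k y01 x01).
    by apply: mulr_gt0; lra.
  - move=> x x01; rewrite flow_poly_deriv.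
    have /andP[h1 h2] := small (flow_deriv_bound k x01); lra.
split.
  exact: (cube_integral_subst (@beta_weight_ge0 _ _ _) (jacobi_beta_integrable adm)
    m1 m2 flow_poly_01 gG uK sub df).
exact: (cube_dom_pull (@beta_weight_ge0 _ _ _) m1 m2 flow_poly_01 gG uK df).
Qed.

End SmallStep.

Lemma expansion_flow_density : expansion flow_density (fun=> 1) (fun t =>
  \sum_(l < N) (kappa * a * flow_left k (tnth t l) + kappa * b * flow_right k (tnth t l) +
                flow_deriv k (tnth t l)) +
  \sum_(j < N) \sum_(l < N | (j < l)%N)
    (2 * kappa) * flow_pair k (tnth t l) (tnth t j)).
Proof.
have cube i (t : N.-tuple R) : in_cube t -> 0 <= tnth t i <= 1.
  by move=> ht; have /andP[/ltW -> /ltW ->] := in_cube_tnth i ht.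
have id0 (h h' : R -> N.-tuple R -> R) : (forall e t, h e t = h' e t) ->
  exists2 e0 : R, 0 < e0 & forall e t, 0 <= e <= e0 -> in_cube t -> h e t = h' e t.
  by exists 1.
have E1 : expansion (fun e t => \prod_(l < N) ((1 + e * flow_left k (tnth t l)) `^ (kappa * a) *
                  (1 + e * flow_right k (tnth t l)) `^ (kappa * b) *
                  (1 + e * flow_deriv k (tnth t l)))) (fun=> 1)
    (fun t => \sum_(l < N) (kappa * a * flow_left k (tnth t l) + kappa * b * flow_right k (tnth t l) +
                flow_deriv k (tnth t l))).
  apply: expansion_prod1 => l _.
  apply: (eq_expansion (id0 _ _ _) _ _ (expansionM (expansionM
     (expansion_powR (f1 := fun t => flow_left k (tnth t l)) (B := k.+2%:R) (kappa * a) _)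
     (expansion_powR (f1 := fun t => flow_right k (tnth t l)) (B := k.+2%:R) (kappa * b) _))
     (expansion_affine (f := fun=> 1) (f1 := fun t => flow_deriv k (tnth t l)) (C := k.+2%:R) _ _))).
  - by [].
  - by move=> t _; rewrite !mulr1.
  - by move=> t _; ring.
  - by move=> t ht; apply: flow_left_bound; exact: cube.
  - by move=> t ht; apply: flow_right_bound; exact: cube.
  - by move=> t ht; rewrite normr1 ler1n.
  - by move=> t ht; apply: flow_deriv_bound; exact: cube.
have E2 : expansion (fun e t => \prod_(j < N) \prod_(l < N | (j < l)%N)
    (1 + e * flow_pair k (tnth t l) (tnth t j)) `^ (2 * kappa)) (fun=> 1)
    (fun t => \sum_(j < N) \sum_(l < N | (j < l)%N)
    (2 * kappa) * flow_pair k (tnth t l) (tnth t j)).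
  apply: expansion_prod1 => j _; apply: expansion_prod1 => l _.
  apply: (expansion_powR (f1 := fun t => flow_pair k (tnth t l) (tnth t j)) (B := k.+2%:R) (2 * kappa)).
  by move=> t ht; apply: flow_pair_bound; exact: cube.
apply: (eq_expansion (id0 _ _ _) _ _ (expansionM E1 E2)).
- by [].
- by move=> t _; rewrite mulr1.
- by move=> t _; rewrite mulr1 mul1r.
Qed.

Lemma expansion_power_sum m :
  expansion (fun e (t : N.-tuple R) => power_sum m (map_tuple (horner (flow_poly k e)) t))
    (power_sum m) (fun t => m%:R * (power_sum (m + k) t - power_sum (m + k.+1) t)).
Proof.
have cube i (t : N.-tuple R) : in_cube t -> 0 <= tnth t i <= 1.
  by move=> ht; have /andP[/ltW -> /ltW ->] := in_cube_tnth i ht.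
have H (i : 'I_N) : expansion
    (fun e (t : N.-tuple R) => (tnth t i + e * (tnth t i ^+ k.+1 - tnth t i ^+ k.+2)) ^+ m)
   (fun t => tnth t i ^+ m) (fun t => m%:R * (tnth t i ^+ m.-1 * (tnth t i ^+ k.+1 - tnth t i ^+ k.+2))).
  apply: (expansion_exp m (h := fun e t => tnth t i + e * (tnth t i ^+ k.+1 - tnth t i ^+ k.+2))).
  apply: (expansion_affine (C := 1)) => t ht; have /andP[x0 x1] := cube i t ht.
    by rewrite ger0_norm.
  have := exprn_ile1 k.+1 x0 x1; have := exprn_ile1 k.+2 x0 x1.
  have := exprn_ge0 k.+1 x0; have := exprn_ge0 k.+2 x0.
  by rewrite ler_norml => *; apply/andP; split; lra.
apply: eq_expansion (expansion_sum (index_enum 'I_N) H) => //.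
- exists 1 => // e t _ _; apply: eq_bigr => i _.
  by rewrite tnth_map horner_flow_poly.
- move=> t _; rewrite -sumrB mulr_sumr; apply: eq_bigr => i _.
  case: m {H} => [|m]; first by rewrite !mul0r.
  by rewrite /= mulrBr -!exprD !addnS !addSn.
Qed.

(** The two sums come from the two monomials of x^(k+1) - x^(k+2); the induction on [s] is the
    Leibniz rule. *)
Lemma expansion_power_prod s :
  expansion (fun e (t : N.-tuple R) => power_prod s (map_tuple (horner (flow_poly k e)) t))
    (power_prod s) (fun t => \sum_(x <- join_terms k s) x.1%:R * power_prod x.2 t -
      \sum_(x <- join_terms k.+1 s) x.1%:R * power_prod x.2 t).
Proof.
elim: s => [|m s IH].
  apply: eq_expansion (expansion_const (C := 1) (f := fun=> 1) _) => //.
  - by exists 1 => // e t _ _; rewrite /power_prod big_nil.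
  - by move=> t _; rewrite /power_prod big_nil.
  - by move=> t _; rewrite !big_nil subrr.
  - by move=> t _; rewrite normr1.
apply: eq_expansion (expansionM (expansion_power_sum m) IH).
- by exists 1 => // e t _ _; rewrite power_prod_cons.
- by move=> t _; rewrite power_prod_cons.
move=> t _; rewrite /= !big_cons !big_map /= !power_prod_cons.
have P j : \sum_(x <- join_terms j s) x.1%:R * power_prod (m :: x.2) t =
    power_sum m t * \sum_(x <- join_terms j s) x.1%:R * power_prod x.2 t.
  by rewrite mulr_sumr; apply: eq_bigr => x _; rewrite power_prod_cons mulrCA.
by rewrite !P; ring.
Qed.

End FlowSubstitution.

Section LoopIdentity.
Context {R : realType}.
Variables (N : nat) (kappa a b : R).
Implicit Types (t : N.-tuple R).

Lemma sum_lt_pairs (S : R -> R -> R) t : (forall x y, S x y = S y x) ->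
  \sum_(j < N) \sum_(l < N | (j < l)%N) 2 * S (tnth t l) (tnth t j) =
  \sum_(j < N) \sum_(l < N) S (tnth t l) (tnth t j) - \sum_(j < N) S (tnth t j) (tnth t j).
Proof.
move=> Ssym.
have -> : \sum_(j < N) \sum_(l < N | (j < l)%N) 2 * S (tnth t l) (tnth t j) =
    \sum_(j < N) \sum_(l < N | (j < l)%N) S (tnth t l) (tnth t j) +
    \sum_(j < N) \sum_(l < N | (l < j)%N) S (tnth t l) (tnth t j).
  rewrite [X in _ = _ + X](exchange_big_dep xpredT) //= -big_split /=.
  apply: eq_bigr => j _; rewrite -big_split /=; apply: eq_bigr => l _.
  by rewrite [S (tnth t j) _]Ssym; ring.
rewrite -sumrB -big_split /=; apply: eq_bigr => j _.
rewrite [X in _ = X - _](bigID (fun l : 'I_N => (j < l)%N)) /=.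
rewrite [X in _ = _ + X - _](bigD1 j) ?ltnn //=.
rewrite [S _ _ + _]addrC addrA addrK; congr (_ + _).
by apply: eq_bigl => l; rewrite -leqNgt ltn_neqAle andbC.
Qed.

Lemma hsum_sym k (x y : R) : hsum k x y = hsum k y x.
Proof.
rewrite /hsum (reindex_inj rev_ord_inj); apply: eq_bigr => i _ /=.
by rewrite mulrC subSS subKn // -ltnS.
Qed.

Lemma hsum_diag k (x : R) : hsum k x x = k.+1%:R * x ^+ k.
Proof.
rewrite /hsum (eq_bigr (fun=> x ^+ k)) => [|i _]; last by rewrite -exprD subnK // -ltnS.
by rewrite sumr_const card_ord mulr_natl.
Qed.

Lemma sum_hsum k t : \sum_(j < N) \sum_(l < N) hsum k (tnth t l) (tnth t j) =
  \sum_(i < k.+1) power_sum i t * power_sum (k - i) t.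
Proof.
transitivity (\sum_(i < k.+1) \sum_(j < N) \sum_(l < N) tnth t l ^+ (k - i) * tnth t j ^+ i).
  by rewrite [RHS]exchange_big; apply: eq_bigr => j _; rewrite [RHS]exchange_big.
apply: eq_bigr => i _; rewrite /power_sum mulr_suml; apply: eq_bigr => j _.
by rewrite mulr_sumr; apply: eq_bigr => l _; rewrite mulrC.
Qed.

Lemma sum_flow_pair k t :
  \sum_(j < N) \sum_(l < N | (j < l)%N) (2 * kappa) * flow_pair k (tnth t l) (tnth t j) =
  kappa * (\sum_(i < k.+1) power_sum i t * power_sum (k - i) t - k.+1%:R * power_sum k t -
   (\sum_(i < k.+2) power_sum i t * power_sum (k.+1 - i) t - k.+2%:R * power_sum k.+1 t)).
Proof.
have H m : \sum_(j < N) \sum_(l < N | (j < l)%N) 2 * hsum m (tnth t l) (tnth t j) =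
    \sum_(i < m.+1) power_sum i t * power_sum (m - i) t - m.+1%:R * power_sum m t.
  rewrite sum_lt_pairs; last exact: hsum_sym.
  rewrite sum_hsum; congr (_ - _); rewrite mulr_sumr; apply: eq_bigr => j _.
  exact: hsum_diag.
rewrite -!H -sumrB mulr_sumr; apply: eq_bigr => j _.
rewrite -sumrB mulr_sumr; apply: eq_bigr => l _.
by rewrite /flow_pair; ring.
Qed.

Lemma sum_flow_single k t :
  \sum_(l < N) (kappa * a * flow_left k (tnth t l) + kappa * b * flow_right k (tnth t l) +
                flow_deriv k (tnth t l)) =
  kappa * a * (power_sum k t - power_sum k.+1 t) - kappa * b * power_sum k.+1 t +
  (k.+1%:R * power_sum k t - k.+2%:R * power_sum k.+1 t).
Proof.
rewrite /power_sum -sumrB !mulr_sumr -sumrB -sumrB -big_split /=.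
apply: eq_bigr => l _; rewrite /flow_left /flow_right /flow_deriv !exprS; ring.
Qed.

(** The left side is the first-order term of the substituted integrand, divided by the weight; the
    vanishing of its integral is thus the loop equation. *)
Lemma flow_derivative_terms k s t :
  \sum_(x <- join_terms k s) x.1%:R * power_prod x.2 t -
    \sum_(x <- join_terms k.+1 s) x.1%:R * power_prod x.2 t +
  power_prod s t * (\sum_(l < N) (kappa * a * flow_left k (tnth t l) +
       kappa * b * flow_right k (tnth t l) + flow_deriv k (tnth t l)) +
    \sum_(j < N) \sum_(l < N | (j < l)%N) (2 * kappa) * flow_pair k (tnth t l) (tnth t j)) =
  lincomb (low_terms kappa a (k.+1 :: s)) (fun s => power_prod s t) -
  lincomb (top_terms kappa a b (k.+1 :: s)) (fun s => power_prod s t).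
Proof.
rewrite sum_flow_pair sum_flow_single /low_terms /top_terms !lincomb_loop.
have H m : \sum_(i < m.+1) power_prod [:: val i, (m - i)%N & s] t =
   (\sum_(i < m.+1) power_sum i t * power_sum (m - i) t) * power_prod s t.
  by rewrite mulr_suml; apply: eq_bigr => i _; rewrite !power_prod_cons mulrA.
rewrite !H !power_prod_cons; ring.
Qed.

End LoopIdentity.

Section JacobiLoop.
Context {R : realType}.
Notation RR := (measurableTypeR R).
Local Open Scope classical_set_scope.
Local Open Scope ring_scope.

Definition jacobi_moment (N : nat) (kappa a b : R) (s : seq nat) : R :=
  jacobi_mean kappa a b (fun lambda : N.-tuple R => \prod_(i <- s) power_sum i lambda).

Variables (N : nat) (kappa a b : R).
Hypothesis adm : jacobi_admissible N kappa a b.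
Notation u := (beta_weight (kappa * a) (kappa * b)).
Notation w := (@jacobi_weight R N kappa a b).

Let u_ge0 : forall x, 0 <= u x. Proof. exact: beta_weight_ge0. Qed.
Let u_int := jacobi_beta_integrable adm.
Let Z_gt0 : 0 < cube_integral w. Proof. exact: jacobi_weight_integral_gt0. Qed.

Lemma cube_dom_lincomb (T : seq (R * seq nat)) :
  cube_dom u (fun t => lincomb T (fun s => power_prod s t) * w t) /\
  cube_integral (fun t => lincomb T (fun s => power_prod s t) * w t) =
  lincomb T (fun s => cube_integral (fun t => power_prod s t * w t)).
Proof.
pose F (x : R * seq nat) t := x.1 * (power_prod x.2 t * w t).
have dF x : cube_dom u (F x) by apply: cube_domZ; exact: cube_dom_power_prod.
have E : (fun t => lincomb T (fun s => power_prod s t) * w t) = (fun t => \sum_(x <- T) F x t).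
  apply/funext => t; rewrite /lincomb mulr_suml; apply: eq_bigr => x _.
  by rewrite /F mulrA.
rewrite E; split; first exact: cube_dom_sum.
rewrite (cube_integral_sum u_ge0 u_int) //; apply: eq_bigr => x _.
by rewrite (cube_integralZ u_ge0 u_int) //; exact: cube_dom_power_prod.
Qed.

Lemma small_multiple_eq0 (x C e0 : R) : 0 <= C -> 0 < e0 ->
  (forall e, 0 < e <= e0 -> e * `|x| <= C * e ^+ 2) -> x = 0.
Proof.
move=> C0 e0_gt0 H; apply/eqP/negPn/negP => x0.
have nx : 0 < `|x| by rewrite normr_gt0.
(* Small enough that [C * e] is at most half of |x|, which contradicts |x| <= C e. *)
pose e := Num.min e0 (`|x| / (2 * (C + 1))).
have C1 : 0 < C + 1 by lra.
have e_gt0 : 0 < e by rewrite lt_min e0_gt0 divr_gt0 // mulr_gt0.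
have := H e; rewrite e_gt0 ge_min lexx /= => /(_ isT).
rewrite expr2 mulrCA ler_pM2l // => le_xCe.
have : e * (2 * (C + 1)) <= `|x| by rewrite -ler_pdivlMr ?mulr_gt0 // ge_min lexx orbT.
nra.
Qed.

(** The substitution turns [F] into [G] without changing the integral, so the integral of [G - F] is
    0; it is also [e] times the integral of [L], up to O(e^2). *)
Lemma loop_integral_eq0 k s :
  cube_integral (fun t => (lincomb (low_terms kappa a (k.+1 :: s)) (fun s => power_prod s t) -
    lincomb (top_terms kappa a b (k.+1 :: s)) (fun s => power_prod s t)) * w t) = 0.
Proof.
set L := fun t => _ * w t.
have [C [e0 [C0 e0_gt0 _ H]]] := expansionM (expansion_power_prod N k s)
  (expansion_flow_density N kappa a b k).
pose F t := power_prod s t * w t.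
have dF : cube_dom u F by exact: cube_dom_power_prod.
have [dlow _] := cube_dom_lincomb (low_terms kappa a (k.+1 :: s)).
have [dtop _] := cube_dom_lincomb (top_terms kappa a b (k.+1 :: s)).
have dL : cube_dom u L.
  have := cube_domD dlow (cube_domZ (-1) dtop).
  by congr cube_dom; apply/funext => t; rewrite /L; ring.
have k0 : 0 < (2 * k.+2%:R)^-1 :> R by rewrite invr_gt0 mulr_gt0.
apply: (small_multiple_eq0 (C := C * cube_integral w) (e0 := Num.min e0 (2 * k.+2%:R)^-1)).
- by rewrite mulr_ge0 // ltW.
- by rewrite lt_min e0_gt0.
move=> e /andP[e_gt0]; rewrite le_min => /andP[ee0 ek].
have e_small : e * k.+2%:R <= 2^-1.
  by move: ek; rewrite invfM ler_pdivlMr.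
have [EF dG] := cube_integral_flow adm (ltW e_gt0) e_small dF.
set G := fun t => _ in EF dG.
have dD : cube_dom u (fun t => G t - F t - e * L t).
  have := cube_domD (cube_domD dG (cube_domZ (-1) dF)) (cube_domZ (- e) dL).
  by congr cube_dom; apply/funext => t; ring.
have dCw : cube_dom u (fun t => (C * e ^+ 2) * w t).
  by apply: cube_domZ; exact: cube_dom_weight.
have dGF : cube_dom u (fun t => G t - F t).
  have := cube_domD dG (cube_domZ (-1) dF).
  by congr cube_dom; apply/funext => t; ring.
(* [H] expands the observable times [flow_density]; multiplied by the weight, this product is [G] by
   [jacobi_weight_flow]. *)
have bnd t : in_cube t -> `|G t - F t - e * L t| <= (C * e ^+ 2) * w t.
  move=> ht; have [||_ _] := H e t; rewrite ?(ltW e_gt0) //.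
  set D1 := (X in e * X); set h := (X in X - _ - _) => hb.
  have -> : G t - F t - e * L t = (h - power_prod s t * 1 - e * D1) * w t.
    rewrite /G /F /L /h /D1 -flow_derivative_terms !mulr1.
    rewrite -mulrA (jacobi_weight_flow _ _ _ (ltW e_gt0) e_small ht); ring.
  rewrite normrM [X in _ * X]ger0_norm ?jacobi_weight_ge0 //.
  by rewrite ler_wpM2r // jacobi_weight_ge0.
have ED : cube_integral (fun t => G t - F t - e * L t) = - (e * cube_integral L).
  rewrite (cube_integralB u_ge0 u_int dGF); last exact: cube_domZ.
  rewrite (cube_integralB u_ge0 u_int dG dF) -EF subrr sub0r.
  by rewrite (cube_integralZ u_ge0 u_int).
have Zw : cube_integral (fun t => (C * e ^+ 2) * w t) = C * e ^+ 2 * cube_integral w.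
  by rewrite (cube_integralZ u_ge0 u_int) //; exact: cube_dom_weight.
rewrite -[X in X * `|_|](ger0_norm (ltW e_gt0)) -normrM -normrN -ED.
have -> : C * cube_integral w * e ^+ 2 = C * e ^+ 2 * cube_integral w by ring.
rewrite -Zw ler_norml; apply/andP; split.
  rewrite -mulN1r -(cube_integralZ u_ge0 u_int) //.
  apply: (le_cube_integral u_ge0 u_int) => //; first exact: cube_domZ.
  by move=> t /bnd; rewrite ler_norml mulN1r => /andP[].
by apply: (le_cube_integral u_ge0 u_int) => // t /bnd; rewrite ler_norml => /andP[].
Qed.

Lemma jacobi_moment_loop : loop_solution N%:R kappa a b (jacobi_moment N kappa a b).
Proof.
have momE s : jacobi_moment N kappa a b s =
    cube_integral (fun t => power_prod s t * w t) / cube_integral w by [].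
split.
- rewrite momE (_ : (fun t => _) = w) ?divff ?gt_eqF //.
  by apply/funext => t; rewrite /power_prod big_nil mul1r.
- move=> s; rewrite !momE mulrA; congr (_ / _).
  rewrite -(cube_integralZ u_ge0 u_int); last exact: cube_dom_power_prod.
  apply: eq_cube_integral => t _; rewrite power_prod_cons mulrA; congr (_ * _ * _).
  rewrite /power_sum (eq_bigr (fun=> 1)) => [|i _]; last by rewrite expr0.
  by rewrite sumr_const card_ord.
- move=> s s' ss'; rewrite !momE; congr (cube_integral _ / _); apply/funext => t.
  by rewrite /power_prod (perm_big _ ss').
move=> [|[|k] s] hs //; have lin T : lincomb T (jacobi_moment N kappa a b) =
    lincomb T (fun s => cube_integral (fun t => power_prod s t * w t)) / cube_integral w.
  by rewrite /lincomb mulr_suml; apply: eq_bigr => x _; rewrite momE mulrA.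
rewrite !lin; congr (_ / _).
have [dlow <-] := cube_dom_lincomb (low_terms kappa a (k.+1 :: s)).
have [dtop <-] := cube_dom_lincomb (top_terms kappa a b (k.+1 :: s)).
apply/esym/eqP; rewrite -subr_eq0 -(cube_integralB u_ge0 u_int dlow dtop).
rewrite -[X in _ == X](loop_integral_eq0 k s); apply/eqP; apply: eq_cube_integral => t _.
by rewrite mulrBl.
Qed.

End JacobiLoop.

(** * Continuity in the parameter a *)

Section JacobiShift.
Context {R : realType}.
Notation RR := (measurableTypeR R).
Local Open Scope classical_set_scope.
Local Open Scope ring_scope.
Variables (N : nat) (kappa b : R).
Hypothesis kappa_gt0 : 0 < kappa.

(** On the cube, [a] enters the weight only through exp (- a Y). As [Y] is nonnegative but may be
    arbitrarily large near the faces where a variable is 0, a small change of [a] is not a factor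
    uniformly close to 1. *)
Let Y (t : N.-tuple R) : R := \sum_(l < N) - (kappa * ln (tnth t l)).

Let Y_ge0 t : in_cube t -> 0 <= Y t.
Proof.
move=> ht; apply: sumr_ge0 => l _; have /andP[x0 x1] := in_cube_tnth l ht.
by rewrite -mulrN mulr_ge0 ?ltW // oppr_gt0 ln_lt0 // x0.
Qed.

Lemma jacobi_weight_shift a d (t : N.-tuple R) : in_cube t ->
  jacobi_weight kappa (a + d) b t = expR (- (d * Y t)) * jacobi_weight kappa a b t.
Proof.
move=> ht; rewrite /jacobi_weight mulrA; congr (_ * _).
rewrite /Y mulr_sumr -sumrN expR_sum -big_split /=; apply: eq_bigr => l _.
have /andP[x0 _] := in_cube_tnth l ht.
rewrite mulrA; congr (_ * _); rewrite /powR gt_eqF // -expRD; congr expR.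
by ring.
Qed.

Lemma cube_dom_shift a d s : jacobi_admissible N kappa a b -> 0 <= d ->
  cube_dom (beta_weight (kappa * a) (kappa * b))
    (fun t : N.-tuple R => power_prod s t * jacobi_weight kappa (a + d) b t).
Proof.
move=> adm d0; split.
  apply: measurable_funM; first exact: measurable_power_prod.
  exact: measurable_jacobi_weight.
exists (N%:R ^+ size s) => [|t ht]; first exact: exprn_ge0.
have /andP[p0 p1] := power_prod_bound s ht.
rewrite normrM ler_pM // ?ger0_norm ?jacobi_weight_ge0 //.
rewrite jacobi_weight_shift // (le_trans _ (jacobi_weight_le adm ht)) //.
rewrite ler_piMl ?jacobi_weight_ge0 // -expR0 ler_expR oppr_le0.
by rewrite mulr_ge0 // Y_ge0.
Qed.

(* With y = - kappa ln (prod t), this is e^(- d y) (1 - e^(- h y)) <= h / d. *)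
Lemma jacobi_integral_lipschitz a d h s : jacobi_admissible N kappa a b -> 0 < d -> 0 < h ->
  `|cube_integral (fun t : N.-tuple R => power_prod s t * jacobi_weight kappa (a + (d + h)) b t) -
    cube_integral (fun t : N.-tuple R => power_prod s t * jacobi_weight kappa (a + d) b t)| <=
  h / d * (N%:R ^+ size s * cube_integral (@jacobi_weight R N kappa a b)).
Proof.
move=> adm d0 h0.
have u0 := @beta_weight_ge0 R (kappa * a) (kappa * b).
have ui := jacobi_beta_integrable adm.
have D1 := cube_dom_shift s adm (ltW d0).
have D2 := cube_dom_shift s adm (ltW (addr_gt0 d0 h0)).
have dw := cube_dom_weight adm.
have D3 := cube_domZ (h / d) (cube_domZ (N%:R ^+ size s) dw).
have key (t : N.-tuple R) : in_cube t -> 0 <= power_prod s t * jacobi_weight kappa (a + d) b t -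
    power_prod s t * jacobi_weight kappa (a + (d + h)) b t <=
    h / d * (N%:R ^+ size s * jacobi_weight kappa a b t).
  move=> ht; have y0 := Y_ge0 ht; have /andP[p0 p1] := power_prod_bound s ht.
  have w0 : 0 <= jacobi_weight kappa a b t by exact: jacobi_weight_ge0.
  rewrite !jacobi_weight_shift // mulrDl opprD expRD.
  set P := power_prod s t in p0 p1 *; set W := jacobi_weight kappa a b t in w0 *.
  set y := Y t in y0 *.
  have -> : P * (expR (- (d * y)) * W) - P * (expR (- (d * y)) * expR (- (h * y)) * W) =
    expR (- (d * y)) * (1 - expR (- (h * y))) * (P * W) by ring.
  have e0 : 0 <= expR (- (d * y)) by exact: expR_ge0.
  have e1 : 0 <= 1 - expR (- (h * y)).
    by rewrite subr_ge0 -expR0 ler_expR oppr_le0 mulr_ge0 // ltW.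
  have e2 : 1 - expR (- (h * y)) <= h * y.
    by have := expR_ge1Dx (- (h * y)); lra.
  have e3 : expR (- (d * y)) * (d * y) <= 1.
    rewrite expRN ler_pdivrMl ?expR_gt0 // mulr1.
    by have := expR_ge1Dx (d * y); lra.
  have e4 : expR (- (d * y)) * (1 - expR (- (h * y))) <= h / d.
    rewrite (le_trans (ler_wpM2l e0 e2)) //.
    have -> : expR (- (d * y)) * (h * y) = h / d * (expR (- (d * y)) * (d * y)).
      by field; rewrite gt_eqF.
    by rewrite ler_piMr // divr_ge0 // ltW.
  apply/andP; split; first by apply: mulr_ge0; exact: mulr_ge0.
  apply: ler_pM => //; [exact: mulr_ge0|exact: mulr_ge0|exact: ler_wpM2r].
rewrite distrC -(cube_integralB u0 ui D1 D2) ger0_norm.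
  rewrite -(cube_integralZ u0 ui) // -(cube_integralZ u0 ui); last exact: cube_domZ.
  apply: (le_cube_integral u0 ui) => //.
    have := cube_domD D1 (cube_domZ (-1) D2).
    by congr cube_dom; apply/funext => t; ring.
  by move=> t /key /andP[].
by apply: cube_integral_ge0 => t /key /andP[].
Qed.

Lemma jacobi_integral_cvg a s : jacobi_admissible N kappa a b ->
  cube_integral (fun t : N.-tuple R => power_prod s t * jacobi_weight kappa (a + h) b t)
    @[h --> 0^'+] -->
  cube_integral (fun t : N.-tuple R => power_prod s t * jacobi_weight kappa a b t).
Proof.
move=> adm; have [N0 _ ka kb] := adm.
(* Puts [kappa * (a - d)] midway between -1 and [kappa * a]: the ensemble at [a - d] is still
   admissible, and the Lipschitz bound based there has [d > 0]. *)
pose d := (kappa * a + 1) / (2 * kappa).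
have d0 : 0 < d by rewrite divr_gt0 ?mulr_gt0 // -ltrBlDr sub0r.
have adm' : jacobi_admissible N kappa (a - d) b.
  split=> //; have -> : kappa * (a - d) = (kappa * a - 1) / 2.
    by rewrite /d; field; rewrite gt_eqF.
  lra.
pose C := d^-1 * (N%:R ^+ size s * cube_integral (@jacobi_weight R N kappa (a - d) b)).
have C0 : 0 <= C.
  rewrite mulr_ge0 ?invr_ge0 ?(ltW d0) // mulr_ge0 ?exprn_ge0 //.
  by rewrite ltW // jacobi_weight_integral_gt0.
apply/cvgrPdist_le => e e0; near=> h.
have h0 : 0 < h by near: h; exact: nbhs_right_gt.
have hC : h <= e / (C + 1).
  by near: h; apply: nbhs_right_le; rewrite divr_gt0 //; lra.
have := jacobi_integral_lipschitz s adm' d0 h0.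
rewrite addrA subrK -mulrA -/C distrC => /le_trans; apply.
apply: le_trans (_ : e / (C + 1) * C <= _); first exact: ler_wpM2r.
rewrite mulrAC ler_pdivrMr; last by lra.
by rewrite ler_pM2l //; lra.
Unshelve. all: by end_near. Qed.

Lemma jacobi_moment_cvg a s : jacobi_admissible N kappa a b ->
  jacobi_moment N kappa (a + h) b s @[h --> 0^'+] --> jacobi_moment N kappa a b s.
Proof.
move=> adm; apply: cvgM; first exact: jacobi_integral_cvg.
apply: cvgV; first by rewrite gt_eqF // jacobi_weight_integral_gt0.
have E c : cube_integral (@jacobi_weight R N kappa c b) =
    cube_integral (fun t : N.-tuple R => power_prod [::] t * jacobi_weight kappa c b t).
  by congr cube_integral; apply/funext => t; rewrite /power_prod big_nil mul1r.
by rewrite E; under eq_fun do rewrite E; exact: jacobi_integral_cvg.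
Qed.

End JacobiShift.

(** * Existence and uniqueness of the rational functions *)

Section JacobiMoments.
Local Open Scope classical_set_scope.
Local Open Scope ring_scope.
Variable R : realType.

Lemma jacobi_cumulantE n (p : 'I_n -> nat) N (kappa a b : R) :
  jacobi_cumulant p N kappa a b = cumulant (jacobi_moment N kappa a b) p.
Proof.
apply: eq_bigr => P _; congr (_ * _); apply: eq_bigr => B _.
congr jacobi_mean; apply/funext => lambda.
by rewrite big_map big_enum.
Qed.

Lemma jacobi_cumulant_cvg n (p : 'I_n -> nat) N (kappa a b : R) :
  jacobi_admissible N kappa a b ->
  jacobi_cumulant p N kappa (a + h) b @[h --> 0^'+] --> jacobi_cumulant p N kappa a b.
Proof.
move=> adm; rewrite jacobi_cumulantE /cumulant.
under eq_fun do rewrite jacobi_cumulantE /cumulant.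
apply: cvg_big => [|P _]; first exact: add_continuous.
apply: cvgM; first exact: cvg_cst.
apply: cvg_big => [|B _]; first exact: mul_continuous.
by apply: jacobi_moment_cvg => //; case: adm.
Qed.

(** The root 0 is split off with its multiplicity: the cofactor is nonzero near 0 by continuity, the
    power of [h] because [h > 0]. *)
Lemma poly_near_neq0 (q : {poly R}) : q != 0 -> \forall h \near 0^'+, q.[h] != 0.
Proof.
move=> q0; have [m [r]] := multiplicity_XsubC q 0.
rewrite q0 /= => r0 ->; near=> h.
rewrite hornerM horner_exp hornerXsubC subr0 mulf_neq0 //.
  near: h; apply: (cvgr_neq0 r.[0]) => //.
  by apply: cvg_at_right_filter; exact: continuous_horner.
by rewrite expf_neq0 // gt_eqF //; near: h; exact: nbhs_right_gt.
Unshelve. all: by end_near. Qed.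

(* Where the determinants vanish, the equality is obtained by letting h tend to
   0+ in the parameter a + h. *)
Lemma jacobi_mu_exists n (p : 'I_n -> nat) : is_jacobi_mu p (cumulant (@ratmu R) p).
Proof.
move=> N kappa a b r adm [P [Q [EPQ Q0 ->]]].
have [N0 k0 ka kb] := adm.
pose v (h : R) := param_point N%:R kappa (a + h) b.
have evalh (S : param_poly R) : exists S' : {poly R}, forall h, mpoly.meval (v h) S = S'.[h].
  exists (mpoly.mmap (@polyC R) (param_point N%:R%:P kappa%:P ('X + a%:P) b%:P) S) => h.
  rewrite mpoly.mevalE /mpoly.mmap horner_sum; apply: eq_bigr => m _.
  rewrite hornerM hornerC; congr (_ * _); rewrite /mpoly.mmap1 horner_prod.
  apply: eq_bigr => i _; rewrite horner_exp; congr (_ ^+ _).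
  by move: i; apply: forall_ord4; rewrite /v !param_pointE !hornerE // addrC.
have [P' EP] := evalh P; have [Q' EQ] := evalh Q.
have v0 : mpoly.meval (v 0) =1 mpoly.meval (param_point N%:R kappa a b).
  by move=> S; rewrite /v addr0.
have [q q0 Eq] := loop_den_shift N%:R a b (\sum_i p i) (lt0r_neq0 k0).
have Q'0 : Q' != 0.
  by apply: contraNneq Q0 => h; rewrite -v0 EQ h horner0.
(* The claim becomes that [P'.[0]] is the cumulant times [Q'.[0]]. Both are limits at 0+ of
   quantities that agree for small [h > 0], where neither the determinants nor the denominator
   vanish. *)
rewrite -!v0 EP EQ; apply/(canLR (mulfK _)); first by rewrite -EQ v0.
have cont (S : {poly R}) : S.[h] @[h --> 0^'+] --> S.[0].
  by apply: cvg_at_right_filter; exact: continuous_horner.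
apply: (@cvg_unique _ _ (P'.[h] @[h --> 0^'+])) => //; first exact: cont.
have : jacobi_cumulant p N kappa (a + h) b * Q'.[h] @[h --> 0^'+] -->
    jacobi_cumulant p N kappa a b * Q'.[0].
  by apply: cvgM; [exact: jacobi_cumulant_cvg|exact: cont].
apply: cvg_trans; apply: near_eq_cvg.
near=> h.
have h0 : 0 < h by near: h; exact: nbhs_right_gt.
have admh : jacobi_admissible N kappa (a + h) b.
  by split=> //; rewrite mulrDr (lt_trans ka) // ltrDl mulr_gt0.
have qh : q.[h] != 0 by near: h; exact: poly_near_neq0.
have Qh : Q'.[h] != 0 by near: h; exact: poly_near_neq0.
have := ratcum_eval (p := p) (jacobi_moment_loop admh); rewrite Eq => /(_ qh).
rewrite -jacobi_cumulantE => /frac_eval_unique E.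
rewrite (E (P'.[h] / Q'.[h])) ?mulfVK //; exists P, Q; rewrite -EP -EQ.
by split=> //; move: Qh; rewrite -EQ.
Unshelve. all: by end_near. Qed.

(** Positive integers are admissible parameters, and a rational function is determined by its values
    on that grid. *)
Lemma jacobi_mu_unique n (p : 'I_n -> nat) (f g : param_ratfun R) :
  is_jacobi_mu p f -> is_jacobi_mu p g -> f = g.
Proof.
move=> hf hg; apply: ratfun_eq_grid => N kappa a b r s hr hs.
have adm : jacobi_admissible N.+1 (kappa.+1%:R : R) a.+1%:R b.+1%:R.
  by split=> //; rewrite (lt_trans (ltrN10 _)) // mulr_gt0.
by rewrite (hf _ _ _ _ _ adm hr) (hg _ _ _ _ _ adm hs).
Qed.

End JacobiMoments.

Theorem proposition4p2 (R : realType) (n : nat) (n_gt0 : (0 < n)%N) :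
  (forall p : 'I_n -> nat, exists! f : param_ratfun R, is_jacobi_mu p f) /\
  forall mu : ('I_n -> nat) -> param_ratfun R,
    (forall p, is_jacobi_mu p (mu p)) ->
    let N := varN R in let kappa := varK R in
    let a := varA R in let b := varB R in
    let mu_dual p :=
      ratfun_subst (mu p) (- kappa * N) kappa^-1 (- kappa * a) (- kappa * b) in
    Wbar mu = scale_series ((- kappa) ^- n) (Wbar mu_dual) /\
    forall p, mu p = (- kappa) ^- n * mu_dual p.
Proof.
split=> [p|mu hmu N kappa a b mu_dual].
  exists (cumulant (@ratmu R) p); split; first exact: jacobi_mu_exists.
  by move=> f hf; apply: jacobi_mu_unique hf; exact: jacobi_mu_exists.
have dual p : mu p = (- kappa) ^- n * mu_dual p.
  (* Uniqueness identifies the given [mu p] with the cumulant of [ratmu]. *)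
  rewrite /mu_dual (jacobi_mu_unique (hmu p) (@jacobi_mu_exists R n p)).
  exact: ratcum_duality.
split=> //; apply/funext => m; rewrite /scale_series /Wbar.
by case: ifP => _; rewrite ?mulr0.
Qed.
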